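(* For all integers $n\geq 0$, $a_3(7^2n+39)\equiv 0 \pmod{7^2}$.
   Context: For an integer $k\geq 1$ let $f_k:=\prod_{n\geq 1}(1-q^{kn})$. For an integer $c\geq 1$, the generalized cubic partition function $a_c(n)$ is defined by the generating function $\sum_{n\geq 0}a_c(n)q^n=\dfrac{1}{f_1f_2^{c-1}}$; in particular $\sum_{n\geq0}a_3(n)q^n=\dfrac{1}{f_1f_2^2}$. *)

(* Defs.v *)
From mathcomp Require Import all_boot.
Set Implicit Arguments. Unset Strict Implicit. Unset Printing Implicit Defensive.

Definition fps := nat -> nat.

Definition fps_mul (A B : fps) : fps :=
  fun n => \sum_(i < n.+1) A i * B (n - i).

Definition fps_one : fps := fun n => (n == 0).

(* The geometric series 1/(1 - q^j) = sum_{t>=0} q^(j t), for j >= 1. *)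
Definition geom (j : nat) : fps := fun n => (j %| n).

(* Truncated version of 1/f_k = prod_{m>=1} 1/(1-q^(k m)): product over
   1 <= m <= N.  Coefficients of q^n with n <= N agree with the infinite
   product, since factors with k m > N contribute only 1 + O(q^(N+1)). *)
Definition inv_f_trunc (k N : nat) : fps :=
  \big[fps_mul/fps_one]_(1 <= m < N.+1) geom (k * m).

(* sum_n a_c(n) q^n = 1/(f_1 f_2^(c-1)) : coefficient of q^n, computed
   from the truncation at order n (which is exact for that coefficient). *)
Definition a_gen (c n : nat) : nat :=
  fps_mul (inv_f_trunc 1 n)
    (\big[fps_mul/fps_one]_(0 <= i < c.-1) inv_f_trunc 2 n) n.

(* Main.v *)
Require Import Defs.
From HB Require Import structures.
From mathcomp Require Import all_boot all_order all_algebra.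
From mathcomp Require Import boolp.
From mathcomp Require Import ring zify.
Set Implicit Arguments. Unset Strict Implicit. Unset Printing Implicit Defensive.
Import Order.TTheory GRing.Theory Num.Theory.
Local Open Scope ring_scope.

(* Write f_k for the Euler products and F = f_2^5/f_1 = psi(q) f_2^3, where
   psi = f_2^2/f_1 is Gauss's series and f_2^3 is Jacobi's. Then
     1/(f_1 f_2^2) = F/f_2^7 = F/f_14 + 7 F V,   7 V = 1/f_2^7 - 1/f_14.
   F is a theta series of the form x^2 + 2 y^2, anisotropic at 7, so its
   coefficients of index 4 mod 7 are divisible by 7 and live on 18 mod 49; with
   the vanishing mod 7 of 1/f_2 on 3 mod 7 this settles F/f_14 mod 49. It remains
   to treat F V mod 7. Rotating lattice sums over Z^2 gives Halphen's equations
   for the logarithmic derivatives of phi(q), phi(-q), psi(q^2), and, with Gauss's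
   product formulas, Jacobi's formula for f_1^3. Modulo 7 the latter says that
   a^7 = a for its coefficients; this third order differential equation is
   E_6 = 1, and it turns the ring generated by e = 2 E_2(q^2) - E_2(q), 1/e and
   theta = q d/dq into polynomials: with t = e^3,
     theta e = (1 - t^2)/e,   E_2(q^2) = (4 t^2 + 2 t + 2)/e^2.
   Since theta V is known and extraction of a residue class mod 7 is a polynomial
   in theta, the class of F V comes out as a combination of q^18 (F^7/f_2)^7 and
   q^4 (f_1^9 f_2^2 e)^7, both of which have zero coefficients on 39 mod 49. *)

(** * The ring of formal power series and its Euler operator *)

Record series (R : Type) := Series { coef : nat -> R }.

Lemma seriesP (R : Type) (x y : series R) : coef x =1 coef y -> x = y.
Proof. by case: x y => [x] [y] /= /funext ->. Qed.

HB.instance Definition _ (R : Type) := gen_eqMixin (series R).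
HB.instance Definition _ (R : Type) := gen_choiceMixin (series R).

Section SeriesRing.
Variable R : comNzRingType.
Implicit Types x y z : series R.

Definition zeros : series R := Series (fun=> 0).
Definition ones : series R := Series (fun n => (n == 0)%:R).
Definition adds x y := Series (fun n => coef x n + coef y n).
Definition opps x := Series (fun n => - coef x n).
Definition muls x y := Series (fun n => \sum_(i < n.+1) coef x i * coef y (n - i)).

Lemma addsA : associative adds.
Proof. by move=> x y z; apply: seriesP => n /=; rewrite addrA. Qed.
Lemma addsC : commutative adds.
Proof. by move=> x y; apply: seriesP => n /=; rewrite addrC. Qed.
Lemma add0s : left_id zeros adds.
Proof. by move=> x; apply: seriesP => n /=; rewrite add0r. Qed.
Lemma addNs : left_inverse zeros opps adds.
Proof. by move=> x; apply: seriesP => n /=; rewrite addNr. Qed.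

HB.instance Definition _ :=
  GRing.isZmodule.Build (series R) addsA addsC add0s addNs.

Lemma mulsC : commutative muls.
Proof.
move=> x y; apply: seriesP => n /=.
rewrite (reindex_inj rev_ord_inj) /=; apply: eq_bigr => i _.
by rewrite mulrC; congr (coef y _ * coef x _); have := ltn_ord i; lia.
Qed.

(* Associativity is inherited from polynomials by truncating at the order of
   the coefficient in question. *)
Definition trunc n x : {poly R} := \poly_(i < n) coef x i.

Lemma coef_muls_trunc N n x y : (n < N)%N ->
  coef (muls x y) n = (trunc N x * trunc N y)`_n.
Proof.
move=> nN; rewrite coefM /=; apply: eq_bigr => i _.
by rewrite !coef_poly (leq_ltn_trans _ nN) ?leq_ord // (leq_ltn_trans _ nN) ?leq_subr.
Qed.

Lemma mulsA : associative muls.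
Proof.
move=> x y z; apply: seriesP => n.
have E u v w : coef (muls u (muls v w)) n
             = (trunc n.+1 u * (trunc n.+1 v * trunc n.+1 w))`_n.
  rewrite coefM /=; apply: eq_bigr => i _.
  rewrite coef_poly ltn_ord -coef_muls_trunc //.
  by rewrite ltnS leq_subr.
rewrite E (mulsC (muls x y)) E.
by congr (_ `_ n); rewrite mulrA mulrC.
Qed.

Lemma mul1s : left_id ones muls.
Proof.
move=> x; apply: seriesP => n /=.
rewrite big_ord_recl /= mul1r subn0 big1 ?addr0 // => i _.
by rewrite mul0r.
Qed.
Lemma mulsDl : left_distributive muls adds.
Proof.
move=> x y z; apply: seriesP => n /=.
by rewrite -big_split; apply: eq_bigr => i _; rewrite mulrDl.
Qed.
Lemma ones_neq0 : ones != zeros.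
Proof.
apply/eqP => /(congr1 (fun x => coef x 0)) /= /eqP.
by rewrite oner_eq0.
Qed.

HB.instance Definition _ := GRing.Zmodule_isComNzRing.Build (series R)
  mulsA mulsC mul1s mulsDl ones_neq0.

Lemma coefs0 n : coef (0 : series R) n = 0. Proof. by []. Qed.
Lemma coefs1 n : coef (1 : series R) n = (n == 0)%:R. Proof. by []. Qed.
Lemma coefsD x y n : coef (x + y) n = coef x n + coef y n. Proof. by []. Qed.
Lemma coefsN x n : coef (- x) n = - coef x n. Proof. by []. Qed.
Lemma coefsB x y n : coef (x - y) n = coef x n - coef y n. Proof. by []. Qed.
Lemma coefsM x y n :
  coef (x * y) n = \sum_(i < n.+1) coef x i * coef y (n - i).
Proof. by []. Qed.
Lemma coefs_sum (I : Type) (r : seq I) (P : pred I) (F : I -> series R) n :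
  coef (\sum_(i <- r | P i) F i) n = \sum_(i <- r | P i) coef (F i) n.
Proof. by elim/big_rec2: _ => // i y1 y2 _ <-. Qed.

Lemma coefsM0 x y : coef (x * y) 0 = coef x 0 * coef y 0.
Proof. by rewrite coefsM big_ord_recl big_ord0 addr0 subn0. Qed.
Lemma coefsX0 x n : coef (x ^+ n) 0 = coef x 0 ^+ n.
Proof. by elim: n => // n IH; rewrite !exprS coefsM0 IH. Qed.
Lemma coefsMn x m n : coef (x *+ m) n = coef x n *+ m.
Proof. by elim: m => // m IH; rewrite !mulrS coefsD IH. Qed.
Lemma coefs_nat m n : coef (m%:R : series R) n = m%:R *+ (n == 0%N).
Proof. by rewrite coefsMn coefs1; case: (n == 0)%N; rewrite ?mulr1n ?mulr0n ?mul0rn. Qed.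

Lemma coefs_natM m x n : coef (m%:R * x) n = m%:R * coef x n.
Proof. by rewrite !mulr_natl coefsMn. Qed.

Definition cst (a : R) : series R := Series (fun n => a *+ (n == 0)%N).
Lemma coefs_cstM a x n : coef (cst a * x) n = a * coef x n.
Proof.
rewrite coefsM big_ord_recl subn0 big1 ?addr0 //= => i _.
by rewrite mul0r.
Qed.
Lemma cstM : {morph cst : a b / a * b}.
Proof.
by move=> a b; apply: seriesP => n; rewrite coefs_cstM /=; case: (n == 0)%N; rewrite ?mulr0.
Qed.
Lemma cst1 : cst 1 = 1. Proof. by []. Qed.

Definition sX (m : nat) : series R := Series (fun n => (n == m)%:R).
Lemma coefs_sXM m x n :
  coef (sX m * x) n = if (m <= n)%N then coef x (n - m) else 0.
Proof.
rewrite coefsM /=; case: leqP => mn.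
  rewrite (bigD1 (Ordinal (mn : m < n.+1)%N)) //= eqxx mul1r big1 ?addr0 // => i.
  by rewrite -val_eqE /= => /negPf ->; rewrite mul0r.
rewrite big1 // => i _; case: eqP => [im|]; last by rewrite mul0r.
by have := ltn_ord i; lia.
Qed.
Lemma sXD m n : sX (m + n) = sX m * sX n.
Proof.
apply: seriesP => i; rewrite coefs_sXM /=; case: leqP => h.
  by have -> : (i == m + n)%N = (i - m == n)%N by apply/eqP/eqP; lia.
by case: eqP => // ?; lia.
Qed.
Lemma sXX m n : sX m ^+ n = sX (m * n).
Proof. by elim: n => [|n IH]; rewrite ?muln0 // exprS IH mulnS sXD. Qed.

(* The Euler operator q d/dq. *)
Definition theta x : series R := Series (fun n => n%:R * coef x n).

Lemma thetaD x y : theta (x + y) = theta x + theta y.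
Proof. by apply: seriesP => n /=; rewrite mulrDr. Qed.
Lemma thetaN x : theta (- x) = - theta x.
Proof. by apply: seriesP => n /=; rewrite mulrN. Qed.
Lemma thetaM x y : theta (x * y) = theta x * y + x * theta y.
Proof.
apply: seriesP => n; rewrite coefsD !coefsM /= big_distrr /= -big_split /=.
apply: eq_bigr => i _.
have {1}-> : n = (i + (n - i))%N by have := ltn_ord i; lia.
by rewrite natrD; ring.
Qed.
Lemma theta1 : theta 1 = 0.
Proof. by apply: seriesP => -[|n] /=; rewrite ?mul0r ?mulr0. Qed.
Lemma theta0 : theta 0 = 0.
Proof. by apply: seriesP => n /=; rewrite mulr0. Qed.
Lemma theta_nat m : theta m%:R = 0.
Proof. by elim: m => [|m IH]; rewrite ?theta0 // mulrS thetaD theta1 IH add0r. Qed.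
Lemma thetaX x n : theta (x ^+ n) = n%:R * x ^+ n.-1 * theta x.
Proof.
elim: n => [|n IH]; first by rewrite expr0 theta1 !mul0r.
rewrite exprS thetaM IH /=; case: n {IH} => [|n] /=; first by rewrite expr0; ring.
by rewrite exprS -[n.+2%:R]natr1; ring.
Qed.
Lemma theta_sX m : theta (sX m) = m%:R * sX m.
Proof.
apply: seriesP => n; rewrite coefs_natM /=.
by case: eqP => [->|] //; rewrite !mulr0.
Qed.

Definition eqm N x y := forall n, (n < N)%N -> coef x n = coef y n.

Lemma eqm_refl N x : eqm N x x. Proof. by []. Qed.
Lemma eqm_sym N x y : eqm N x y -> eqm N y x. Proof. by move=> h n /h. Qed.
Lemma eqm_trans N y x z : eqm N x y -> eqm N y z -> eqm N x z.
Proof. by move=> h1 h2 n nN; rewrite h1 ?h2. Qed.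
Lemma eqmM N x x' y y' : eqm N x x' -> eqm N y y' -> eqm N (x * y) (x' * y').
Proof.
move=> h1 h2 n nN; rewrite !coefsM; apply: eq_bigr => i _.
by rewrite h1 ?h2 // ?(leq_ltn_trans (leq_subr _ _)) // (leq_trans (ltn_ord i)).
Qed.
Lemma eqmX N x x' k : eqm N x x' -> eqm N (x ^+ k) (x' ^+ k).
Proof. by move=> h; elim: k => // k IH; rewrite !exprS; apply: eqmM. Qed.
Lemma eqm_leq M N x y : (M <= N)%N -> eqm N x y -> eqm M x y.
Proof. by move=> MN h n nM; apply: h; apply: leq_trans MN. Qed.
Lemma eqm_all x y : (forall N, eqm N x y) -> x = y.
Proof. by move=> h; apply: seriesP => n; apply: (h n.+1). Qed.

(* Inverse of a series with constant term 1, as a geometric series. *)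
Definition geos x N := \sum_(k < N) (1 - x) ^+ k.
Definition invs x : series R := Series (fun n => coef (geos x n.+1) n).

Lemma ordX x k n : coef x 0 = 0 -> (n < k)%N -> coef (x ^+ k) n = 0.
Proof.
move=> x0; elim: k n => // k IH n nk; rewrite exprS coefsM.
rewrite big1 // => -[[|i] /= i_n] _; first by rewrite x0 mul0r.
by rewrite IH ?mulr0 //; lia.
Qed.

Lemma mulVs x : coef x 0 = 1 -> invs x * x = 1.
Proof.
move=> x0; apply: eqm_all => N.
have y0 : coef (1 - x) 0 = 0 by rewrite coefsB x0 coefs1 subrr.
have E : eqm N (invs x) (geos x N).
  move=> n nN; rewrite /= /geos !coefs_sum -(subnKC nN) big_split_ord /=.
  by rewrite [X in _ = _ + X]big1 ?addr0 // => i _; apply: ordX => //; lia.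
apply: (eqm_trans (eqmM E (@eqm_refl N x))) => n nN.
have -> : geos x N * x = 1 - (1 - x) ^+ N.
  rewrite -[X in X - _](expr1n _ N) subrXX /geos mulrC.
  congr (_ * _); first by ring.
  by apply: eq_bigr => i _; rewrite expr1n mul1r.
by rewrite coefsB ordX // subr0.
Qed.

Lemma mulsV x : coef x 0 = 1 -> x * invs x = 1.
Proof. by rewrite mulrC; apply: mulVs. Qed.
Lemma invs0 x : coef x 0 = 1 -> coef (invs x) 0 = 1.
Proof.
move=> x0; have : coef (invs x * x) 0 = 1 by rewrite mulVs.
by rewrite coefsM0 x0 mulr1.
Qed.
Lemma cancels x y z : coef x 0 = 1 -> x * y = x * z -> y = z.
Proof.
by move=> x0 /(congr1 ( *%R (invs x))); rewrite !mulrA !mulVs // !mul1r.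
Qed.
Lemma invs_uniq x y : coef x 0 = 1 -> x * y = 1 -> y = invs x.
Proof. by move=> x0 xy; apply: (cancels x0); rewrite xy mulsV. Qed.

Lemma invsX x n : coef x 0 = 1 -> invs (x ^+ n) = invs x ^+ n.
Proof.
move=> x0; symmetry; apply: invs_uniq; first by rewrite coefsX0 x0 expr1n.
by rewrite -exprMn mulsV ?expr1n.
Qed.
End SeriesRing.

(** * Theta series in one and two variables *)

(** Enumerated from the outside in, so that symmetric partial sums of a theta series grow by two
    terms at a time, as in Shanks's identities below. *)
Fixpoint box (B : nat) : seq int :=
  if B is B'.+1 then Posz B :: - Posz B :: box B' else [:: 0].

Lemma mem_box B i : (i \in box B) = (`|i| <= B)%N.
Proof.
elim: B => [|B IH]; first by rewrite inE; apply/eqP/idP; lia.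
rewrite /= !inE IH; apply/idP/idP; lia.
Qed.

Lemma uniq_box B : uniq (box B).
Proof.
elim: B => //= B IH; rewrite inE !mem_box IH andbT.
by apply/andP; split; [apply/norP; split; [apply/eqP|]|]; lia.
Qed.

Definition box2 B := [seq (i, j) | i <- box B, j <- box B].

Lemma mem_box2 B p : (p \in box2 B) = (`|p.1| <= B)%N && (`|p.2| <= B)%N.
Proof.
apply/allpairsP/idP => [[[i j]] /= [hi hj ->]|/andP[h1 h2]].
  by rewrite -!mem_box hi.
by exists p; rewrite !mem_box h1 h2; split=> //; case: p {h1 h2}.
Qed.

Lemma uniq_box2 B : uniq (box2 B).
Proof. by apply: allpairs_uniq; rewrite ?uniq_box // => -[? ?] []. Qed.

Lemma big_mem_uniq (T : eqType) (V : zmodType) (r1 r2 : seq T) (P : pred T)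
    (F : T -> V) : uniq r1 -> uniq r2 ->
    (forall x, P x -> (x \in r1) = (x \in r2)) ->
  \sum_(x <- r1 | P x) F x = \sum_(x <- r2 | P x) F x.
Proof.
move=> u1 u2 h; rewrite -[LHS]big_filter -[RHS]big_filter; apply: perm_big.
apply: uniq_perm; rewrite ?filter_uniq // => x; rewrite !mem_filter.
by case Px: (P x) => //=; apply: h.
Qed.

(** The series sum of c(i) q^(E i). Summing over [box n] misses no term of exponent n once |i| <= E
    i, which is [dominated]. *)
Definition th (c : int -> int) (E : int -> nat) : series int :=
  Series (fun n => \sum_(i <- box n | E i == n) c i).
Definition th2 (c : int * int -> int) (E : int * int -> nat) : series int :=
  Series (fun n => \sum_(p <- box2 n | E p == n) c p).

Definition dominated (E : int -> nat) := forall i, (`|i| <= E i)%N.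
Definition dominated2 (E : int * int -> nat) :=
  forall p, (`|p.1| <= E p)%N && (`|p.2| <= E p)%N.

Lemma coef_th_box c E n B : dominated E -> (n <= B)%N ->
  coef (th c E) n = \sum_(i <- box B | E i == n) c i.
Proof.
move=> hE nB /=; apply: big_mem_uniq; rewrite ?uniq_box // => i /eqP Ei.
by rewrite !mem_box; have := hE i; lia.
Qed.

Lemma eq_th c c' E : c =1 c' -> th c E = th c' E.
Proof. by move=> h; apply: seriesP => n /=; apply: eq_bigr => i _. Qed.
Lemma eq_th2 c c' E : c =1 c' -> th2 c E = th2 c' E.
Proof. by move=> h; apply: seriesP => n /=; apply: eq_bigr => i _. Qed.

Lemma thD c c' E : th c E + th c' E = th (fun i => c i + c' i) E.
Proof. by apply: seriesP => n /=; rewrite big_split. Qed.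
Lemma th_natM a c E : a%:R * th c E = th (fun i => a%:R * c i) E.
Proof. by apply: seriesP => n; rewrite coefs_natM /= big_distrr. Qed.
Lemma theta_th c E : theta (th c E) = th (fun i => (E i)%:R * c i) E.
Proof.
by apply: seriesP => n /=; rewrite big_distrr /=; apply: eq_bigr => i /eqP ->.
Qed.
Lemma th2D c c' E : th2 c E + th2 c' E = th2 (fun i => c i + c' i) E.
Proof. by apply: seriesP => n /=; rewrite big_split. Qed.
Lemma th2N c E : - th2 c E = th2 (fun i => - c i) E.
Proof. by apply: seriesP => n /=; rewrite sumrN. Qed.
Lemma th2_natM a c E : a%:R * th2 c E = th2 (fun i => a%:R * c i) E.
Proof. by apply: seriesP => n; rewrite coefs_natM /= big_distrr. Qed.

Lemma thM c1 E1 c2 E2 : dominated E1 -> dominated E2 ->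
  th c1 E1 * th c2 E2 =
  th2 (fun p => c1 p.1 * c2 p.2) (fun p => E1 p.1 + E2 p.2)%N.
Proof.
move=> h1 h2; apply: seriesP => n; rewrite coefsM [RHS]big_mkcond big_allpairs.
transitivity (\sum_(a < n.+1) \sum_(i <- box n) \sum_(j <- box n)
    (if E1 i == a then c1 i else 0) * (if E2 j == (n - a)%N then c2 j else 0)).
  apply: eq_bigr => a _; have an := ltn_ord a.
  rewrite (@coef_th_box c1 E1 a n) // (@coef_th_box c2 E2 (n - a) n) ?leq_subr //.
  by rewrite big_mkcond [X in _ * X]big_mkcond big_distrlr.
rewrite exchange_big; apply: eq_bigr => i _.
rewrite exchange_big; apply: eq_bigr => j _.
case: (leqP (E1 i) n) => hi; last first.
  rewrite big1 => [|a _] /=; first by case: eqP => //; lia.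
  by case: eqP => [?|]; rewrite ?mul0r //; have := ltn_ord a; lia.
rewrite (bigD1 (Ordinal (hi : E1 i < n.+1)%N)) //= eqxx big1 ?addr0 => [|a].
  have -> : (E2 j == n - E1 i)%N = (E1 i + E2 j == n)%N by apply/eqP/eqP; lia.
  by case: eqP; rewrite ?mulr0.
rewrite -val_eqE /= => ha; case: eqP => [ha'|]; rewrite ?mul0r //.
by rewrite -ha' eqxx in ha.
Qed.

(** Injectivity matches the terms on the image of f; off the image the weight c' vanishes, which
    covers rotations onto a sublattice of index 2. *)
Lemma th2_reindex f c E c' E' : injective f -> dominated2 E -> dominated2 E' ->
  (forall p, E' (f p) = E p) -> (forall p, c' (f p) = c p) ->
  (forall q, c' q = 0 \/ exists p, f p = q) -> th2 c' E' = th2 c E.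
Proof.
move=> f_inj hE hE' Ef cf surj; apply: seriesP => n /=.
pose L := [seq f p | p <- box2 n & E p == n].
have -> : \sum_(p <- box2 n | E p == n) c p = \sum_(q <- L) c' q.
  by rewrite big_map big_filter; apply: eq_bigr => p _; rewrite cf.
rewrite (bigID (mem L)) /= [X in _ + X]big1 ?addr0 => [|q /andP[/eqP qn qL]].
  rewrite -big_filter; apply: perm_big; apply: uniq_perm.
  - by rewrite filter_uniq ?uniq_box2.
  - by rewrite map_inj_uniq ?filter_uniq ?uniq_box2.
  move=> q; rewrite mem_filter mem_box2.
  apply/idP/idP => [/andP[/andP[]]|qL] //.
  have /mapP[p] := qL; rewrite mem_filter => /andP[/eqP pn _] qp.
  by have := hE' q; rewrite qL qp Ef pn eqxx.
case: (surj q) => // -[p pq]; case/negP: qL; apply/mapP; exists p => //.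
by rewrite mem_filter mem_box2 -pq Ef in qn *; have := hE p; rewrite qn eqxx.
Qed.

(** Characters of Z with values 1 and -1; they treat theta series at q and at -q together. *)
Definition is_sign (s : int -> int) :=
  (forall i j, s (i + j) = s i * s j) /\ (forall i, s i * s i = 1).
Definition triv_sign (i : int) : int := 1.
Definition alt_sign (i : int) : int := (-1) ^+ `|i|%N.

Lemma is_sign_triv : is_sign triv_sign. Proof. by []. Qed.
Lemma is_sign_alt : is_sign alt_sign.
Proof.
split=> [i j|i]; last by rewrite /alt_sign -expr2 sqrr_sign.
rewrite /alt_sign -exprD -signr_odd -[RHS]signr_odd; congr ((-1) ^+ nat_of_bool _).
lia.
Qed.

Lemma is_signB s i j : is_sign s -> s (i - j) = s i * s j.
Proof.
move=> [sD s2]; rewrite sD; congr (_ * _).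
have s0 : s 0 = 1 by rewrite -[RHS](s2 0) -sD addr0.
by rewrite -[LHS]mul1r -(s2 j) -mulrA -sD subrr s0 mulr1.
Qed.

Definition E_sq (i : int) : nat := absz (i * i)%R.
(** For i in Z the values 2 i^2 + i run through the triangular numbers, each taken once. *)
Definition E_tri (i : int) : nat := absz (2 * i * i + i)%R.
Definition E_tri2 (i : int) : nat := absz (4 * i * i + 2 * i)%R.
Definition E_sq2 (i : int) : nat := absz (2 * i * i)%R.

Lemma E_sqE i : (E_sq i)%:R = i * i :> int.
Proof. by rewrite /E_sq natz; nia. Qed.
Lemma E_triE i : (E_tri i)%:R = 2 * i * i + i :> int.
Proof. by rewrite /E_tri natz; nia. Qed.
Lemma E_tri2E i : (E_tri2 i)%:R = 4 * i * i + 2 * i :> int.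
Proof. by rewrite /E_tri2 natz; nia. Qed.
Lemma E_sq2E i : (E_sq2 i)%:R = 2 * i * i :> int.
Proof. by rewrite /E_sq2 natz; nia. Qed.

Lemma dominated_sq : dominated E_sq.
Proof. by move=> i; rewrite /E_sq; nia. Qed.
Lemma dominated_tri : dominated E_tri.
Proof. by move=> i; rewrite /E_tri; nia. Qed.
Lemma dominated_tri2 : dominated E_tri2.
Proof. by move=> i; rewrite /E_tri2; nia. Qed.
Lemma dominated_sq2 : dominated E_sq2.
Proof. by move=> i; rewrite /E_sq2; nia. Qed.

Lemma dominated_pair E1 E2 : dominated E1 -> dominated E2 ->
  dominated2 (fun p => E1 p.1 + E2 p.2)%N.
Proof. by move=> h1 h2 p /=; have := h1 p.1; have := h2 p.2; lia. Qed.

(* phi s = phi(q) or phi(-q), and psi s = psi(q) or psi(-q), according to the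
   sign character s; the series of psi is sum_i q^(((4i+1)^2-1)/8). *)
Definition phi s := th s E_sq.
Definition psi s := th s E_tri.
Definition psi2 := th triv_sign E_tri2.
Definition phi2 := th alt_sign E_sq2.
(** Jacobi's sum over k >= 0 of (-1)^k (2k+1) q^(k(k+1)/2): the numbers 4i + 1 are exactly the
    (-1)^k (2k+1). *)
Definition jac := th (fun i => 4 * i + 1) E_tri.

(** * Rotations of the lattice and Halphen's equations *)

Lemma int_halfP (x : int) : exists y : int, x = 2 * y \/ x = 2 * y + 1.
Proof. by exists (x %/ 2)%Z; lia. Qed.

Definition rot (p : int * int) : int * int :=
  (p.1 - p.2, if (2 %| p.1 + p.2)%Z then ((p.1 + p.2) %/ 2)%Z
              else - ((p.1 + p.2 + 1) %/ 2)%Z).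

Lemma rot_inj : injective rot.
Proof.
move=> [a b] [c d]; rewrite /rot /= => -[h1].
case: ifP => h; case: ifP => h' h2; congr (_, _); lia.
Qed.

Lemma rotP p : exists y, (p.1 + p.2 = 2 * y /\ rot p = (p.1 - p.2, y)) \/
  (p.1 + p.2 = 2 * y + 1 /\ rot p = (p.1 - p.2, - (y + 1))).
Proof.
case: p => a b; rewrite /rot /=; have [y [h|h]] := int_halfP (a + b).
  by exists y; left; split=> //; congr (_, _); case: ifP; lia.
by exists y; right; split=> //; congr (_, _); case: ifP; lia.
Qed.

Lemma rot_surj q : exists p, rot p = q.
Proof.
case: q => j i; have [y [->|->]] := int_halfP j.
  by exists (i + y, i - y); rewrite /rot /=; congr (_, _); [|case: ifP]; lia.
by exists (y - i, - i - y - 1); rewrite /rot /=; congr (_, _); [|case: ifP]; lia.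
Qed.

Lemma eq_natz (m n : nat) : m%:R = n%:R :> int -> m = n.
Proof. by rewrite !natz => -[]. Qed.

(* With x = 4m+1 and y = 4n+1, the numbers a = (x+y)/2 and b = (x-y)/2 are
   respectively odd and even; up to the sign of a they are 4i+1 and 2j. *)
Lemma rotate s (P Q : int -> int -> int) : is_sign s ->
  (forall a b, P (a + b) (a - b) = Q a b) -> (forall a b, Q (- a) b = Q a b) ->
  th2 (fun p => P (4 * p.1 + 1) (4 * p.2 + 1) * (s p.1 * s p.2))
      (fun p => E_tri p.1 + E_tri p.2)%N =
  th2 (fun p => Q (4 * p.2 + 1) (2 * p.1) * s p.1)
      (fun p => E_sq p.1 + E_tri2 p.2)%N.
Proof.
move=> hs PQ Qe; symmetry; apply: (th2_reindex rot_inj).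
- exact: dominated_pair dominated_tri dominated_tri.
- exact: dominated_pair dominated_sq dominated_tri2.
- move=> p; apply: eq_natz; rewrite !natrD !E_triE E_sqE E_tri2E.
  case: p => m n; have [y [[h ->]|[h ->]]] := rotP (m, n); rewrite /= in h *.
    have -> : m = 2 * y - n by lia.
    by ring.
  have -> : m = 2 * y + 1 - n by lia.
  by ring.
- case=> m n; have [y [[h ->]|[h ->]]] := rotP (m, n);
    rewrite /= in h *; rewrite (is_signB _ _ hs) -PQ; congr (_ * _).
    by congr (P _ _); lia.
  by rewrite PQ -Qe -PQ; congr (P _ _); lia.
- by move=> q; right; apply: rot_surj.
Qed.

(** The involution identifies the series with its negative, and Z has no 2-torsion. *)
Lemma th2_odd0 c E (f : int * int -> int * int) : involutive f -> dominated2 E ->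
  (forall p, E (f p) = E p) -> (forall p, c (f p) = - c p) -> th2 c E = 0.
Proof.
move=> fK hE Ef cf.
have : th2 c E = th2 (fun p => - c p) E.
  apply: (th2_reindex (inv_inj fK)) => // q.
  by right; exists (f q).
rewrite -th2N => h; apply: seriesP => n.
have := congr1 (fun x => coef x n) h; rewrite coefsN coefs0.
by move: (coef _ n) => z hz; lia.
Qed.

(* The pairs of opposite parity cancel in pairs under (x, y) -> (y, x). *)
Lemma rotate2 (P Q : int -> int -> int) :
  (forall a b, P (a + b) (a - b) = Q a b) -> (forall a b, P a b = P b a) ->
  th2 (fun p => P p.1 p.2 * alt_sign p.2) (fun p => E_sq p.1 + E_sq p.2)%N =
  th2 (fun p => Q p.1 p.2 * (alt_sign p.1 * alt_sign p.2))
      (fun p => E_sq2 p.1 + E_sq2 p.2)%N.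
Proof.
move=> PQ Pc.
pose c p := P p.1 p.2 * alt_sign p.2.
pose c1 p := if (2 %| p.1 - p.2)%Z then c p else 0.
pose c2 p := if (2 %| p.1 - p.2)%Z then 0 else c p.
have -> : th2 (fun p => P p.1 p.2 * alt_sign p.2)
    (fun p => E_sq p.1 + E_sq p.2)%N = th2 c1 (fun p => E_sq p.1 + E_sq p.2)%N.
  rewrite -[RHS]addr0.
  rewrite -(@th2_odd0 c2 (fun p => E_sq p.1 + E_sq p.2)%N (fun p => (p.2, p.1))).
  - rewrite th2D; apply: eq_th2 => p; rewrite /c1 /c2.
    by case: ifP; rewrite ?addr0 ?add0r.
  - by case.
  - exact: dominated_pair dominated_sq dominated_sq.
  - by move=> p /=; rewrite addnC.
  case=> i j; rewrite /c2 /c /=.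
  have -> : (2 %| j - i)%Z = (2 %| i - j)%Z by lia.
  case: ifP => h; first by rewrite oppr0.
  rewrite Pc -mulrN; congr (_ * _).
  rewrite /alt_sign -signr_odd -[in RHS]signr_odd.
  have -> : odd `|i| = ~~ odd `|j| by lia.
  by rewrite signrN.
apply: (@th2_reindex (fun p => (p.1 + p.2, p.1 - p.2))).
- by move=> [a b] [c' d] [h1 h2]; congr (_, _); lia.
- exact: dominated_pair dominated_sq2 dominated_sq2.
- exact: dominated_pair dominated_sq dominated_sq.
- by move=> p /=; apply: eq_natz; rewrite !natrD !E_sqE !E_sq2E; ring.
- case=> a b; rewrite /c1 /c /= PQ (is_signB _ _ is_sign_alt) ifT //; lia.
case=> i j; rewrite /c1 /=; case: ifP => h; [right|by left].
by exists (((i + j) %/ 2)%Z, ((i - j) %/ 2)%Z); rewrite /=; congr (_, _); lia.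
Qed.

(** Used to complete squares: 8 E_tri + 1 and 4 E_tri2 + 1 are (4i+1)^2, and 4 E_sq is (2i)^2, so
    the operators [X], [W], [V] below insert squares of the rotated coordinates as weights. *)
Lemma th_op a b c E w : (forall i, a%:R * (E i)%:R + b%:R = w i) ->
  a%:R * theta (th c E) + b%:R * th c E = th (fun i => w i * c i) E.
Proof.
move=> h; rewrite theta_th !th_natM thD; apply: eq_th => i.
by rewrite -h; ring.
Qed.

Section Ops.
Variable s : int -> int.
Let X x : series int := 8%:R * theta x + x.
Let W x : series int := 4%:R * theta x + x.
Let V x : series int := 4%:R * theta x.

Lemma X_tri c : X (th c E_tri) = th (fun i => (4 * i + 1) ^+ 2 * c i) E_tri.
Proof.
rewrite -(@th_op 8 1) => [|i]; first by rewrite /X mul1r.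
by rewrite E_triE; ring.
Qed.
Lemma W_tri2 c : W (th c E_tri2) = th (fun i => (4 * i + 1) ^+ 2 * c i) E_tri2.
Proof.
rewrite -(@th_op 4 1) => [|i]; first by rewrite /W mul1r.
by rewrite E_tri2E; ring.
Qed.
Lemma V_sq c : V (th c E_sq) = th (fun i => (2 * i) ^+ 2 * c i) E_sq.
Proof.
rewrite -(@th_op 4 0) => [|i]; first by rewrite /V mul0r addr0.
by rewrite E_sqE; ring.
Qed.
Lemma V_sq2 c : V (th c E_sq2) = th (fun i => 2 * (2 * i) ^+ 2 * c i) E_sq2.
Proof.
rewrite -(@th_op 4 0) => [|i]; first by rewrite /V mul0r addr0.
by rewrite E_sq2E; ring.
Qed.

Hypothesis hs : is_sign s.

Lemma psi_sqr : psi s * psi s = phi s * psi2.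
Proof.
have := @rotate s (fun _ _ => 1) (fun _ _ => 1) hs (fun _ _ => erefl) (fun _ _ => erefl).
rewrite /psi /phi /psi2 (thM _ _ dominated_tri dominated_tri).
rewrite (thM _ _ dominated_sq dominated_tri2) => h.
under eq_th2 do rewrite -[_ * _]mul1r; rewrite h; apply: eq_th2 => p.
by rewrite mul1r mulr1.
Qed.

(** The weight is the harmonic quartic Re (x + iy)^4. As (a+b) + i(a-b) = (1+i)(a - ib) and (1+i)^4
    = -4, the rotation multiplies it by -4. *)
Lemma psi_quartic :
  X (X (psi s)) * psi s + psi s * X (X (psi s)) - 6%:R * (X (psi s) * X (psi s)) =
  - (4%:R * (phi s * W (W psi2) - 6%:R * (V (phi s) * W psi2)
     + V (V (phi s)) * psi2)).
Proof.
pose P (x y : int) := x ^+ 4 - 6 * x ^+ 2 * y ^+ 2 + y ^+ 4.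
pose Q (a b : int) := - 4 * P a b.
have := @rotate s P Q hs.
move=> /(_ (fun a b => ltac:(rewrite /Q /P; ring))).
move=> /(_ (fun a b => ltac:(rewrite /Q /P; ring))) h.
rewrite /psi /phi /psi2 !X_tri !V_sq !W_tri2 !(thM _ _ dominated_tri dominated_tri).
rewrite !(thM _ _ dominated_sq dominated_tri2).
do ![rewrite th2_natM | rewrite th2N | rewrite th2D].
transitivity (th2 (fun p : int * int => P (4 * p.1 + 1) (4 * p.2 + 1) * (s p.1 * s p.2))
    (fun p => E_tri p.1 + E_tri p.2)%N).
  by apply: eq_th2 => p; rewrite /P; ring.
by rewrite h; apply: eq_th2 => p; rewrite /Q /P /triv_sign; ring.
Qed.

(** The rotation turns the weight x y into a^2 - b^2. *)
Lemma jac_sqr : s =1 triv_sign ->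
  jac * jac = phi s * W psi2 - V (phi s) * psi2.
Proof.
move=> s1; have := @rotate s (fun x y => x * y) (fun a b => a ^+ 2 - b ^+ 2) hs.
move=> /(_ (fun a b => ltac:(ring)) (fun a b => ltac:(ring))) h.
rewrite /jac /phi /psi2 !V_sq !W_tri2 (thM _ _ dominated_tri dominated_tri).
rewrite !(thM _ _ dominated_sq dominated_tri2) th2N th2D.
transitivity (th2 (fun p : int * int => (4 * p.1 + 1) * (4 * p.2 + 1) * (s p.1 * s p.2))
    (fun p => E_tri p.1 + E_tri p.2)%N).
  by apply: eq_th2 => p; rewrite !s1 /triv_sign; ring.
by rewrite h; apply: eq_th2 => p; rewrite /triv_sign; ring.
Qed.

(** The same harmonic quartic, times 16 because [V] inserts (2i)^2 in place of i^2. *)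
Lemma phi_quartic : let u := phi triv_sign in let v := phi alt_sign in
  u * V (V v) - 6%:R * (V u * V v) + V (V u) * v =
  - (phi2 * V (V phi2) - 6%:R * (V phi2 * V phi2) + V (V phi2) * phi2).
Proof.
pose P (x y : int) := 16 * (x ^+ 4 - 6 * x ^+ 2 * y ^+ 2 + y ^+ 4).
pose Q (a b : int) := - 4 * P a b.
have := @rotate2 P Q.
move=> /(_ (fun a b => ltac:(rewrite /Q /P; ring))).
move=> /(_ (fun a b => ltac:(rewrite /P; ring))) h.
rewrite /phi /phi2 !V_sq !V_sq2 !(thM _ _ dominated_sq dominated_sq).
rewrite !(thM _ _ dominated_sq2 dominated_sq2).
do ![rewrite th2_natM | rewrite th2N | rewrite th2D].
transitivity (th2 (fun p : int * int => P p.1 p.2 * alt_sign p.2)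
    (fun p => E_sq p.1 + E_sq p.2)%N).
  by apply: eq_th2 => p; rewrite /P /triv_sign; ring.
by rewrite h; apply: eq_th2 => p; rewrite /Q /P; ring.
Qed.

Lemma phi_sqr : phi triv_sign * phi alt_sign = phi2 * phi2.
Proof.
have h := @rotate2 (fun _ _ => 1) (fun _ _ => 1) (fun _ _ => erefl) (fun _ _ => erefl).
rewrite /phi /phi2 (thM _ _ dominated_sq dominated_sq).
rewrite (thM _ _ dominated_sq2 dominated_sq2).
transitivity (th2 (fun p => 1 * alt_sign p.2) (fun p => E_sq p.1 + E_sq p.2)%N) => //.
by rewrite h; apply: eq_th2 => p; rewrite mul1r.
Qed.
End Ops.

(** * Logarithmic derivatives of the theta series *)

Definition logd (R : comNzRingType) (x : series R) := theta x * invs x.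

Lemma theta_logd (R : comNzRingType) (x : series R) :
  coef x 0 = 1 -> theta x = logd x * x.
Proof. by move=> x0; rewrite /logd -mulrA mulVs // mulr1. Qed.

Lemma series_natI n (x y : series int) :
  (0 < n)%N -> n%:R * x = n%:R * y -> x = y.
Proof.
move=> n0 h; apply: seriesP => m.
have := congr1 (fun z => coef z m) h; rewrite !coefs_natM => /mulfI; apply.
by rewrite pnatr_eq0 -lt0n.
Qed.

Lemma sign0 s : is_sign s -> s 0 = 1.
Proof. by move=> [sD s2]; rewrite -[RHS](s2 0) -sD addr0. Qed.

Lemma coef0_phi s : is_sign s -> coef (phi s) 0 = 1.
Proof. by move=> /sign0 s0; rewrite /= big_cons big_nil /= s0 addr0. Qed.
Lemma coef0_psi s : is_sign s -> coef (psi s) 0 = 1.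
Proof. by move=> /sign0 s0; rewrite /= big_cons big_nil /= s0 addr0. Qed.
Lemma coef0_psi2 : coef psi2 0 = 1.
Proof. by rewrite /= big_cons big_nil. Qed.
Lemma coef0_phi2 : coef phi2 0 = 1.
Proof. by rewrite /= big_cons big_nil. Qed.
Lemma coef0_jac : coef jac 0 = 1.
Proof. by rewrite /= big_cons big_nil. Qed.

(** With [hA3], these are four times the logarithmic derivatives of Jacobi's theta_3, theta_4 and
    theta_2 = 2 q^(1/4) psi(q^2); the factor q^(1/4) accounts for the 1 in [hA3]. *)
Definition hA s : series int := 4%:R * logd (phi s).
Definition hA1 := hA triv_sign.
Definition hA2 := hA alt_sign.
(* Locked, for otherwise rewriting with additivity of theta would unfold it. *)
Definition hA3 : series int := locked (1 + 4%:R * logd psi2).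

Lemma theta_phi s : is_sign s -> 4%:R * theta (phi s) = hA s * phi s.
Proof. by move=> hs; rewrite (theta_logd (coef0_phi hs)) mulrA. Qed.
Lemma theta_psi2 : 4%:R * theta psi2 = (hA3 - 1) * psi2.
Proof. by rewrite (theta_logd coef0_psi2) /hA3 -lock; ring. Qed.

(** Logarithmic differentiation of [psi_sqr]. *)
Lemma theta_psi s : is_sign s -> 8%:R * theta (psi s) = (hA s + hA3 - 1) * psi s.
Proof.
move=> hs; apply: (cancels (coef0_psi hs)).
have := congr1 (@theta _) (psi_sqr hs); rewrite !thetaM => h.
have -> : psi s * (8%:R * theta (psi s)) = 4%:R * (theta (psi s) * psi s + psi s * theta (psi s)).
  by ring.
rewrite h.
have -> : 4%:R * (theta (phi s) * psi2 + phi s * theta psi2) =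
  (4%:R * theta (phi s)) * psi2 + phi s * (4%:R * theta psi2) by ring.
rewrite (theta_phi hs) theta_psi2 [RHS]mulrCA (psi_sqr hs).
by ring.
Qed.

Lemma theta_natM (R : comNzRingType) n (x : series R) :
  theta (n%:R * x) = n%:R * theta x.
Proof. by rewrite thetaM theta_nat mul0r add0r. Qed.

(** Divided by psi^2 = phi(q) psi(q^2), [psi_quartic] becomes an equation for p = hA s + hA3 in
    which the terms p^2 cancel, leaving 32 theta p = 32 hA s hA3. *)
Lemma halphen_psi s : is_sign s -> theta (hA s + hA3) = hA s * hA3.
Proof.
move=> hs; have := psi_quartic hs.
set p := hA s + hA3.
(* Moving psi out of 8 theta + 1 turns it into 8 theta + p; the other two operators become 4 theta +
   hA3 and 4 theta + hA s. *)
have X1 x : 8%:R * theta (x * psi s) + x * psi s = (8%:R * theta x + p * x) * psi s.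
  rewrite thetaM mulrDr [_ * (x * _)]mulrCA (theta_psi hs) /p; ring.
have W1 x : 4%:R * theta (x * psi2) + x * psi2 = (4%:R * theta x + hA3 * x) * psi2.
  rewrite thetaM mulrDr [_ * (x * _)]mulrCA theta_psi2; ring.
have V1 x : 4%:R * theta (x * phi s) = (4%:R * theta x + hA s * x) * phi s.
  rewrite thetaM mulrDr [_ * (x * _)]mulrCA (theta_phi hs); ring.
have -> : 8%:R * theta (psi s) + psi s = p * psi s.
  by rewrite -[psi s]mul1r X1 theta1; ring.
have -> : 4%:R * theta psi2 + psi2 = hA3 * psi2.
  by rewrite -[psi2]mul1r W1 theta1; ring.
rewrite (theta_phi hs) X1 W1 V1 => h.
have {}h : phi s * psi2 * (2%:R * (8%:R * theta p + p * p) - 6%:R * (p * p)) =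
  phi s * psi2 * (- (4%:R * ((4%:R * theta hA3 + hA3 * hA3) - 6%:R * (hA s * hA3)
      + (4%:R * theta (hA s) + hA s * hA s)))).
  by rewrite -{1}(psi_sqr hs); move: h; 
     move: (psi s) (phi s) => u v h; apply: (etrans _ (etrans h _)); ring.
have u0 : coef (phi s * psi2) 0 = 1 by rewrite coefsM0 coef0_phi // coef0_psi2 mulr1.
apply: (@series_natI 32) => //; move/(cancels u0): h; rewrite /p thetaD => h.
have -> : 32%:R * (theta (hA s) + theta hA3) =
  2%:R * (8%:R * (theta (hA s) + theta hA3) + (hA s + hA3) * (hA s + hA3)) - 6%:R * ((hA s + hA3) * (hA s + hA3))
  + 4%:R * (hA s + hA3) * (hA s + hA3) + 16%:R * (theta (hA s) + theta hA3) by ring.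
by rewrite h; ring.
Qed.

(** The same argument on [phi_quartic]; by [phi_sqr] the logarithmic derivative C of phi(-q^2) is
    half of hA1 + hA2. *)
Lemma halphen_phi : theta (hA1 + hA2) = hA1 * hA2.
Proof.
have h1 := theta_phi is_sign_triv; have h2 := theta_phi is_sign_alt.
pose C : series int := 4%:R * logd phi2.
have hC : 4%:R * theta phi2 = C * phi2.
  by rewrite (theta_logd coef0_phi2) mulrA.
have u0 : coef (phi2 * phi2) 0 = 1 by rewrite coefsM0 coef0_phi2 mulr1.
have C2 : 2%:R * C = hA1 + hA2.
  apply: (cancels u0).
  have := congr1 (@theta _) phi_sqr; rewrite !thetaM => h.
  transitivity (4%:R * (theta phi2 * phi2 + phi2 * theta phi2)).
    transitivity (2%:R * ((4%:R * theta phi2) * phi2)); last by ring.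
    by rewrite hC; ring.
  rewrite -h -phi_sqr /hA1 /hA2.
  transitivity ((4%:R * theta (phi triv_sign)) * phi alt_sign +
    phi triv_sign * (4%:R * theta (phi alt_sign))); first by ring.
  by rewrite h1 h2; ring.
have V1 (x z y : series int) : 4%:R * theta x = z * x -> 4%:R * theta (y * x) = (4%:R * theta y + z * y) * x.
  by move=> h; rewrite thetaM mulrDr [_ * (y * _)]mulrCA h; ring.
have := phi_quartic; rewrite /= h1 h2 hC (V1 _ _ _ h1) (V1 _ _ _ h2) (V1 _ _ _ hC).
rewrite -/hA1 -/hA2 => h.
have {}h : phi2 * phi2 *
   ((4%:R * theta hA1 + hA1 * hA1) - 6%:R * (hA1 * hA2) + (4%:R * theta hA2 + hA2 * hA2)) =
   phi2 * phi2 * (- (2%:R * (4%:R * theta C + C * C) - 6%:R * (C * C))).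
  rewrite -{1}phi_sqr; apply: (etrans _ (etrans h _)); ring.
move/(cancels u0): h => h.
have tC : theta hA1 + theta hA2 = 2%:R * theta C by rewrite -thetaD -C2 theta_natM.
apply: (@series_natI 8) => //; rewrite thetaD.
have -> : 8%:R * (theta hA1 + theta hA2) = 
  (4%:R * theta hA1 + hA1 * hA1 - 6%:R * (hA1 * hA2) + (4%:R * theta hA2 + hA2 * hA2)) +
  4%:R * (theta hA1 + theta hA2) - (hA1 + hA2) ^+ 2 + 8%:R * (hA1 * hA2) by ring.
by rewrite h tC -C2; ring.
Qed.

(** The coefficient of q^n in theta x = a x expresses (n - m) x_n by earlier coefficients, so x is
    determined by those up to index m. *)
Lemma ode_uniq (a x y : series int) m : coef a 0 = m%:R ->
  theta x = a * x -> theta y = a * y -> (forall i, (i <= m)%N -> coef x i = coef y i) -> x = y.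
Proof.
move=> a0 hx hy h0; apply: seriesP => n; elim/ltn_ind: n => n IH.
case: (leqP n m) => [/h0 //|mn].
have hz z : theta z = a * z -> (n%:R - m%:R) * coef z n = \sum_(i < n) coef a i.+1 * coef z (n - i.+1).
  move=> /(congr1 (fun z => coef z n)); rewrite coefsM big_ord_recl subn0 a0 /= => h.
  by rewrite mulrBl h; ring.
have nm : n%:R - m%:R != 0 :> int by rewrite subr_eq0 eqr_nat; lia.
apply: (mulfI nm); rewrite !hz //; apply: eq_bigr => i _; congr (_ * _).
by apply: IH; have := ltn_ord i; lia.
Qed.

Lemma coef_logd0 (R : comNzRingType) (x : series R) : coef (logd x) 0 = 0.
Proof. by rewrite coefsM0 [coef (theta x) 0]/= !mul0r. Qed.
Lemma coefsM1 (R : comNzRingType) (x y : series R) :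
  coef (x * y) 1 = coef x 0 * coef y 1 + coef x 1 * coef y 0.
Proof. by rewrite coefsM 2!big_ord_recl big_ord0 addr0. Qed.
Lemma coef_logd1 (R : comNzRingType) (x : series R) :
  coef x 0 = 1 -> coef (logd x) 1 = coef x 1.
Proof.
move=> x0; rewrite coefsM1 invs0 // [coef (theta x) 0]/= [coef (theta x) 1]/=.
by rewrite !mul0r add0r mul1r mulr1.
Qed.

Lemma coef_hA0 s : coef (hA s) 0 = 0.
Proof. by rewrite coefs_natM coef_logd0 mulr0. Qed.
Lemma coef_hA30 : coef hA3 0 = 1.
Proof. by rewrite /hA3 -lock coefsD coefs_natM coef_logd0 mulr0 addr0. Qed.

Lemma halphen_sub31 : theta (hA3 - hA1) = hA2 * (hA3 - hA1).
Proof.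
have := halphen_psi is_sign_alt; have := halphen_phi.
rewrite -/hA2 !thetaD thetaN => h1 h2.
have -> : theta hA3 - theta hA1 = (theta hA2 + theta hA3) - (theta hA1 + theta hA2) by ring.
by rewrite h1 h2; ring.
Qed.

(** Both sides solve theta x = hA2 x and have constant term 1. *)
Lemma phi_alt4 : hA3 - hA1 = phi alt_sign ^+ 4.
Proof.
apply: (@ode_uniq hA2 _ _ 0); rewrite ?coef_hA0 //.
- exact: halphen_sub31.
- by rewrite thetaX mulrAC (theta_phi is_sign_alt) -mulrA -exprS.
- move=> i; rewrite leqn0 => /eqP ->.
  by rewrite coefsB coef_hA30 coef_hA0 coefsX0 coef0_phi ?expr1n //; apply: is_sign_alt.
Qed.

(** Both sides solve theta x = (hA1 + hA3) x, where hA1 + hA3 begins with 1, so two coefficients are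
    compared. The 16 is 8 - (-8), from the q-coefficients of hA1 and hA2. *)
Lemma psi8 : (hA3 - hA2) * (hA1 - hA2) = 16%:R * (sX _ 1 * psi triv_sign ^+ 8).
Proof.
have e1 := halphen_psi is_sign_triv; have e2 := halphen_psi is_sign_alt.
have e3 := halphen_phi; rewrite -/hA1 -/hA2 !thetaD in e1 e2 e3.
apply: (@ode_uniq (hA1 + hA3) _ _ 1).
- by rewrite coefsD coef_hA0 coef_hA30 add0r.
- rewrite thetaM !thetaD !thetaN.
  have -> : theta hA3 - theta hA2 = (theta hA1 + theta hA3) - (theta hA1 + theta hA2) by ring.
  have -> : theta hA1 - theta hA2 = (theta hA1 + theta hA3) - (theta hA2 + theta hA3) by ring.
  by rewrite e1 e2 e3; ring.
- rewrite theta_natM thetaM theta_sX thetaX.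
  have := theta_psi is_sign_triv; rewrite -/hA1 => h.
  have -> : 8%:R * psi triv_sign ^+ 8.-1 * theta (psi triv_sign) =
    psi triv_sign ^+ 7 * (8%:R * theta (psi triv_sign)) by rewrite /=; ring.
  by rewrite h; ring.
have c1 s : is_sign s -> coef (phi s) 1 = s 1 + s (-1).
  by move=> hs; rewrite /= !big_cons big_nil /= addr0.
have cA s : is_sign s -> coef (hA s) 1 = 4 * (s 1 + s (-1)).
  by move=> hs; rewrite coefs_natM coef_logd1 ?coef0_phi // c1.
move=> i i1; rewrite coefs_natM coefs_sXM.
have {i1} [->|->] : i = 0%N \/ i = 1%N by lia.
  by rewrite coefsM0 !coefsB !coef_hA0 coef_hA30 mulr0.
rewrite coefsM1 !coefsB coef_hA30 !coef_hA0.
rewrite !cA; [|exact: is_sign_alt|exact: is_sign_triv].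
rewrite leqnn subnn coefsX0 (coef0_psi is_sign_triv) expr1n /triv_sign /alt_sign.
by rewrite subrr mulr0 addr0.
Qed.

Lemma jac_sqrE : jac * jac = phi triv_sign * psi2 * phi alt_sign ^+ 4.
Proof.
rewrite (jac_sqr is_sign_triv) // (theta_phi is_sign_triv) theta_psi2 -/hA1 -phi_alt4.
ring.
Qed.

(** * The theta products of Gauss and Jacobi *)

Section EulerProducts.
Variable R : comNzRingType.

Definition prodq (k N : nat) : series R := \prod_(1 <= m < N.+1) (1 - sX R (k * m)).
Definition eprod (k : nat) : series R := Series (fun n => coef (prodq k n) n).

Lemma prodqS k N : prodq k N.+1 = prodq k N * (1 - sX R (k * N.+1)).
Proof. by rewrite /prodq big_nat_recr. Qed.

Lemma eqm_sX0 N m (x : series R) : (N <= m)%N -> eqm N (sX R m * x) 0.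
Proof. by move=> Nm n nN; rewrite coefs_sXM leqNgt (leq_trans nN Nm). Qed.

Lemma coef_prodq k n M : (0 < k)%N -> (n <= M)%N ->
  coef (prodq k M) n = coef (prodq k n) n.
Proof.
move=> k0 /subnKC <-; elim: (M - n)%N => [|d IH]; first by rewrite addn0.
rewrite addnS prodqS mulrBr mulr1 coefsB IH.
rewrite mulrC (@eqm_sX0 n.+1) ?subr0 //.
by nia.
Qed.

Lemma eqm_prodq k N M : (0 < k)%N -> (N <= M)%N -> eqm N.+1 (eprod k) (prodq k M).
Proof.
by move=> k0 NM n nN; rewrite (coef_prodq k0) //; apply: leq_trans NM.
Qed.

Lemma coef0_1subX m : (0 < m)%N -> coef (1 - sX R m) 0 = 1.
Proof. by case: m => // m _; rewrite coefsB /= subr0. Qed.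
Lemma coef0_1addX m : (0 < m)%N -> coef (1 + sX R m) 0 = 1.
Proof. by case: m => // m _; rewrite coefsD /= addr0. Qed.
Lemma coef0_eprod k : coef (eprod k) 0 = 1.
Proof. by rewrite /= /prodq big_geq. Qed.
End EulerProducts.

(** * Shanks's finite forms of Gauss's product formulas *)

Section Shanks.
Let q : series int := sX _ 1.
Let sXE m : sX _ m = q ^+ m :> series int.
Proof. by rewrite sXX mul1n. Qed.

Variable g : nat -> series int.
Let Rp (n s : nat) : series int := \prod_(s.+1 <= k < n.+1) g k.
Let RpS n s : (s <= n)%N -> Rp n.+1 s = Rp n s * g n.+1.
Proof. by move=> sn; rewrite /Rp big_nat_recr. Qed.
Let Rpl n s : (s < n)%N -> Rp n s = g s.+1 * Rp n s.+1.
Proof. by move=> sn; rewrite /Rp big_ltn. Qed.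
Let Rpn n : Rp n n = 1. Proof. by rewrite /Rp big_geq. Qed.

Section Psi.
Let v k : series int := invs (1 - q ^+ k).
Let vK k : (1 - q ^+ k.+1) * v k.+1 = 1.
Proof. by rewrite /v -sXE mulsV ?coef0_1subX. Qed.
Hypothesis gE : forall k, g k.+1 = (1 - q ^+ (2 * k + 2)) * v (2 * k + 1).

(** Here [Rp n s] is P_n/P_s for the partial products P of g. The sum is a partial sum of psi up to
    one term, and for large n only s = 0, the product itself, survives at low order. *)
Definition shanks_psi n := \sum_(s < n) Rp n s * q ^+ (s * (2 * n + 1)).

Lemma shanks_psiS n : shanks_psi n.+1 =
  shanks_psi n + q ^+ (n * (2 * n + 1)) + q ^+ (n.+1 * (2 * n + 1)).
Proof.
rewrite /shanks_psi; set V := v (2 * n + 1).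
have VK : (1 - q ^+ (2 * n + 1)) * V = 1 by rewrite /V addn1 vK.
(* The differences of the summands telescope to a closed form; at m = n it combines with the new
   summand s = n into the two new theta terms. *)
have tele m : (m <= n)%N ->
  \sum_(s < m) (Rp n.+1 s * q ^+ (s * (2 * n.+1 + 1)) - Rp n s * q ^+ (s * (2 * n + 1))) =
  Rp n m * (1 - q ^+ (2 * m)) * q ^+ (m * (2 * n + 1)) * V.
  elim: m => [|m IH] mn; first by rewrite big_ord0 muln0 expr0 subrr mulr0 !mul0r.
  rewrite big_ord_recr /= IH ?(ltnW mn) // (RpS (ltnW mn)) gE -/V (Rpl mn) gE.
  have vm : (1 - q ^+ (2 * m + 1)) * v (2 * m + 1) = 1 by rewrite addn1 vK.
  have -> : (m * (2 * n.+1 + 1) = m * (2 * n + 1) + 2 * m)%N by lia.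
  have -> : (m.+1 * (2 * n + 1) = m * (2 * n + 1) + (2 * n + 1))%N by lia.
  have -> : (2 * n + 2 = (2 * n + 1) + 1)%N by lia.
  have -> : (2 * m.+1 = 2 * m + 2)%N by lia.
  move: vm VK; clear IH.
  move: (m * (2 * n + 1))%N => c0; move: (2 * m)%N (2 * n)%N => b0 a0; rewrite !exprD !expr1.
  move: (q ^+ b0) (q ^+ a0) (q ^+ c0) (v _) V (Rp _ _) => b a c w V1 r vm VK.
  (* both sides agree once [vm] and [VK] are used to absorb one factor each *)
  transitivity (r * c * ((1 - b * q ^+ 2) * w) * V1 * (a * q * (1 - b * q)) +
     r * c * ((1 - b * q ^+ 2) * w) * ((1 - a * q) * V1 - 1)); first by ring.
  rewrite VK subrr mulr0 addr0.
  transitivity (r * c * (1 - b * q ^+ 2) * V1 * (a * q) * ((1 - b * q) * w)); first by ring.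
  by rewrite vm; ring.
rewrite big_ord_recr /= -[in RHS]addrA -[LHS](subrK (\sum_(s < n) Rp n s * q ^+ (s * (2 * n + 1)))).
rewrite [RHS]addrC; congr (_ + _).
rewrite addrAC -sumrB tele // (RpS (leqnn n)) Rpn gE -/V.
have -> : (n * (2 * n.+1 + 1) = n * (2 * n + 1) + 2 * n)%N by lia.
have -> : (n.+1 * (2 * n + 1) = n * (2 * n + 1) + (2 * n + 1))%N by lia.
have -> : (2 * n + 2 = (2 * n + 1) + 1)%N by lia.
move: VK; clear tele; move: (n * (2 * n + 1))%N => c0; move: (2 * n)%N => a0; rewrite !exprD !expr1.
move: (q ^+ a0) (q ^+ c0) V => a c V1 VK.
transitivity (((1 - a * q) * V1) * (c * (1 + a * q))); first by ring.
by rewrite VK; ring.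
Qed.

Lemma shanks_psiE n : \sum_(i <- box n) sX _ (E_tri i) =
  shanks_psi n + sX _ (n * (2 * n + 1)).
Proof.
elim: n => [|n IH]; first by rewrite /shanks_psi big_ord0 big_cons big_nil addr0 add0r.
rewrite shanks_psiS /= !big_cons IH -!sXE.
have -> : E_tri (Posz n.+1) = (n.+1 * (2 * n.+1 + 1))%N by rewrite /E_tri; lia.
have -> : E_tri (- Posz n.+1) = (n.+1 * (2 * n + 1))%N by rewrite /E_tri; nia.
by ring.
Qed.

Lemma shanks_psi_lim n : eqm n.+1 (shanks_psi n.+1) (Rp n.+1 0).
Proof.
move=> i ni; rewrite /shanks_psi big_ord_recl mul0n mulr1 coefsD coefs_sum big1 ?addr0 // => s _.
by rewrite mulrC -sXE (@eqm_sX0 _ n.+1) //= /bump /=; nia.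
Qed.
End Psi.

Section Phi.
Let w k : series int := invs (1 + q ^+ k).
Let wK k : (1 + q ^+ k.+1) * w k.+1 = 1.
Proof. by rewrite /w -sXE mulsV ?coef0_1addX. Qed.
Hypothesis gE : forall k, g k.+1 = (1 - q ^+ k.+1) * w k.+1.

(** This is 2/(1 + q^k) for every k; at k = 0 the value is set by hand, since [invs] inverts only
    series with constant term 1. *)
Let c k : series int := if k is 0 then 1 else 2%:R * w k.
Let cK k : (1 + q ^+ k) * c k = 2%:R.
Proof. by case: k => [|k]; rewrite ?expr0 ?mulr1 // /c mulrCA wK mulr1. Qed.

Definition shanks_phi n := \sum_(s < n.+1) (-1) ^+ s * Rp n s * c s * q ^+ (s * n.+1).

Lemma shanks_phiS n : shanks_phi n.+1 = shanks_phi n + (-1) ^+ n.+1 * 2%:R * q ^+ (n.+1 * n.+1).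
Proof.
rewrite /shanks_phi; set W := w n.+1; set a := q ^+ n.+1.
have WK : (1 + a) * W = 1 by rewrite /W /a wK.
have step m : (m <= n)%N -> (-1) ^+ m * Rp n m * (1 - q ^+ m) * c m * q ^+ (m * n.+1) * W +
   ((-1) ^+ m * Rp n.+1 m * c m * q ^+ (m * n.+2) - (-1) ^+ m * Rp n m * c m * q ^+ (m * n.+1))
   = (-1) ^+ m.+1 * Rp n m * 2%:R * q ^+ (m.+1 * n.+1) * W.
  move=> mn; rewrite (RpS mn) gE -/W -/a.
  have -> : (m * n.+2 = m * n.+1 + m)%N by lia.
  have -> : (m.+1 * n.+1 = m * n.+1 + n.+1)%N by lia.
  rewrite -(cK m) !exprD -/a [(-1) ^+ m.+1]exprS.
  move: (q ^+ m) (q ^+ (m * _)) (Rp _ _) (c m) ((-1) ^+ m) => b d r cm e.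
  apply/eqP; rewrite -subr_eq0; apply/eqP.
  transitivity (e * r * cm * d * ((1 + a) * W - 1)); first by ring.
  by rewrite WK subrr mulr0.
have tele m : (m <= n)%N ->
  \sum_(s < m) ((-1) ^+ s * Rp n.+1 s * c s * q ^+ (s * n.+2) - (-1) ^+ s * Rp n s * c s * q ^+ (s * n.+1)) =
  (-1) ^+ m * Rp n m * (1 - q ^+ m) * c m * q ^+ (m * n.+1) * W.
  elim: m => [|m IH] mn; first by rewrite big_ord0 expr0 subrr mulr0 !mul0r.
  rewrite big_ord_recr /= IH ?(ltnW mn) // (step _ (ltnW mn)) (Rpl mn) gE /c.
  by ring.
rewrite big_ord_recr [in LHS]/= Rpn mulr1.
rewrite -[X in X + _ = _](subrK (\sum_(s < n.+1) (-1) ^+ s * Rp n s * c s * q ^+ (s * n.+1))).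
rewrite [X in X + _ = _]addrC -addrA; congr (_ + _).
rewrite -sumrB big_ord_recr /= tele // step // Rpn.
have -> : (n.+1 * n.+2 = n.+1 * n.+1 + n.+1)%N by lia.
rewrite exprD -/a /c -/W.
transitivity ((-1) ^+ n.+1 * 2%:R * q ^+ (n.+1 * n.+1) * ((1 + a) * W)); first by ring.
by rewrite WK mulr1.
Qed.

Lemma shanks_phiE n : \sum_(i <- box n) cst (alt_sign i) * sX _ (E_sq i) = shanks_phi n.
Proof.
elim: n => [|n IH].
  by rewrite /shanks_phi big_ord_recl big_ord0 big_cons big_nil Rpn !mul1r mul0n.
rewrite shanks_phiS /= !big_cons IH -!sXE.
have -> : E_sq (Posz n.+1) = (n.+1 * n.+1)%N by rewrite /E_sq; lia.
have -> : E_sq (- Posz n.+1) = (n.+1 * n.+1)%N by rewrite /E_sq; lia.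
have -> : cst (alt_sign (Posz n.+1)) = (-1) ^+ n.+1.
  rewrite /alt_sign absz_nat; elim: (n.+1) => // m IHm.
  rewrite exprS cstM IHm exprS; congr (_ * _).
  by apply: seriesP => -[].
by ring.
Qed.

Lemma shanks_phi_lim n : eqm n.+1 (shanks_phi n) (Rp n 0).
Proof.
move=> i ni; rewrite /shanks_phi big_ord_recl mul0n !mulr1 mul1r coefsD coefs_sum big1 ?addr0 // => s _.
by rewrite mulrC -sXE (@eqm_sX0 _ n.+1) //= /bump /=; nia.
Qed.
End Phi.
End Shanks.

Definition psi_fac (k : nat) : series int :=
  (1 - sX _ 1 ^+ (2 * k)) * invs (1 - sX _ 1 ^+ (2 * k).-1).
Definition phi_fac (k : nat) : series int :=
  (1 - sX _ 1 ^+ k) * invs (1 + sX _ 1 ^+ k).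

Lemma sX1E m : sX _ m = sX _ 1 ^+ m :> series int.
Proof. by rewrite sXX mul1n. Qed.

Lemma coef_th_sum c E n B : dominated E -> (n <= B)%N ->
  coef (th c E) n = coef (\sum_(i <- box B) cst (c i) * sX _ (E i)) n.
Proof.
move=> hE nB; rewrite (coef_th_box c hE nB) coefs_sum big_mkcond; apply: eq_bigr => i _.
by rewrite coefs_cstM /= eq_sym; case: eqP; rewrite ?mulr1 ?mulr0.
Qed.

Lemma psi_prod n : eqm n.+1 (psi triv_sign) (\prod_(1 <= k < n.+2) psi_fac k).
Proof.
move=> i ni; have gE k : psi_fac k.+1 = (1 - sX _ 1 ^+ (2 * k + 2)) * invs (1 - sX _ 1 ^+ (2 * k + 1)).
  rewrite /psi_fac; have -> : ((2 * k.+1).-1 = 2 * k + 1)%N by lia.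
  by have -> : (2 * k.+1 = 2 * k + 2)%N by lia.
rewrite -(shanks_psi_lim psi_fac ni) (coef_th_sum triv_sign dominated_tri (ltnW ni)).
under eq_bigr do rewrite cst1 mul1r.
rewrite (shanks_psiE gE) coefsD -[sX _ _]mulr1 (@eqm_sX0 _ n.+1) ?addr0 //.
by rewrite leq_pmulr // addn1.
Qed.

Lemma phi_prod n : eqm n.+1 (phi alt_sign) (\prod_(1 <= k < n.+1) phi_fac k).
Proof.
move=> i ni; rewrite -(shanks_phi_lim phi_fac ni) (coef_th_sum alt_sign dominated_sq (ltnSE ni)).
by rewrite (@shanks_phiE phi_fac (fun k => erefl)).
Qed.

Lemma gauss_psi : psi triv_sign * eprod _ 1 = eprod _ 2 ^+ 2.
Proof.
apply: eqm_all => -[|n] //.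
(* With f_1 cut at twice the order, its odd factors cancel the denominators of [psi_fac] and its
   even ones give f_2: an exact finite identity, by induction. *)
have h1 : eqm n.+1 (eprod _ 1) (prodq int 1 (2 * n.+1)) by apply: eqm_prodq => //; lia.
have h2 : eqm n.+1 (eprod _ 2) (prodq int 2 n.+1).
  by apply: eqm_leq (eqm_prodq (N := n.+1) _ _ _) => //.
apply: (eqm_trans (eqmM (@psi_prod n) h1)); apply/eqm_sym.
apply: (eqm_trans (eqmX 2 h2)) => i _; congr (coef _ i); rewrite expr2.
elim: n.+1 {h1 h2 i} => [|m IH]; first by rewrite /prodq !big_geq // mulr1.
rewrite (prodqS _ 2 m) [in RHS]big_nat_recr //=.
have -> : (2 * m.+1 = (2 * m).+2)%N by lia.
rewrite !prodqS !mul1n /psi_fac -!sX1E.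
have -> : ((2 * m.+1).-1 = (2 * m).+1)%N by lia.
have -> : (2 * m.+1 = (2 * m).+2)%N by lia.
have hv := mulsV (coef0_1subX int (ltn0Sn (2 * m))).
move: hv IH; move: (invs _) => v; move: (sX _ (2 * m).+1) (sX _ (2 * m).+2) => a b hv IH.
transitivity (prodq int 2 m * prodq int 2 m * (1 - b) ^+ 2 * ((1 - a) * v)).
  by rewrite hv; ring.
by rewrite IH; ring.
Qed.

Lemma gauss_phi : phi alt_sign * eprod _ 2 = eprod _ 1 ^+ 2.
Proof.
apply: eqm_all => -[|n] //.
have h1 : eqm n.+1 (eprod _ 1) (prodq int 1 n) by apply: eqm_prodq.
have h2 : eqm n.+1 (eprod _ 2) (prodq int 2 n) by apply: eqm_prodq.
apply: (eqm_trans (eqmM (@phi_prod n) h2)); apply/eqm_sym.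
apply: (eqm_trans (eqmX 2 h1)) => i _; congr (coef _ i); rewrite expr2.
elim: n {h1 h2 i} => [|m IH]; first by rewrite /prodq !big_geq // mulr1.
rewrite (prodqS _ 2 m) (prodqS _ 1 m) [in RHS]big_nat_recr //=.
rewrite mul1n mulnC muln2 -addnn sXD /phi_fac -!sX1E.
have hv := mulsV (coef0_1addX int (ltn0Sn m)).
move: hv IH; move: (invs _) => v; move: (sX _ m.+1) => a hv IH.
transitivity (prodq int 1 m * prodq int 1 m * (1 - a) ^+ 2 * ((1 + a) * v)).
  by rewrite hv; ring.
by rewrite IH; ring.
Qed.

(** Gauss's products show that both sides have the same square. Their sum has constant term 2, hence
    is no zero divisor, so their difference is 0. *)
Lemma jacobi : jac = eprod _ 1 ^+ 3.
Proof.
have f20 : coef (eprod int 2) 0 = 1 by apply: coef0_eprod.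
have h : jac ^+ 2 = (eprod _ 1 ^+ 3) ^+ 2.
  have c0 : coef (eprod int 2 ^+ 4 * eprod int 1 ^+ 2) 0 = 1.
    by rewrite coefsM0 !coefsX0 !coef0_eprod !expr1n.
  apply: (cancels c0).
  rewrite [jac ^+ 2]expr2 jac_sqrE -(psi_sqr is_sign_triv).
  transitivity ((psi triv_sign * eprod _ 1) ^+ 2 * (phi alt_sign * eprod _ 2) ^+ 4); first by ring.
  by rewrite gauss_psi gauss_phi; ring.
have := subr_sqr jac (eprod _ 1 ^+ 3); rewrite h subrr => h0.
apply/eqP; rewrite -subr_eq0; apply/eqP.
move: h0; set d := jac - _; set s := jac + _ => h0.
have s0 : coef s 0 = 2 by rewrite coefsD coef0_jac coefsX0 coef0_eprod.
apply: seriesP => n; elim/ltn_ind: n => n IH.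
have := congr1 (fun z => coef z n) h0; rewrite coefs0 mulrC coefsM big_ord_recl s0 subn0.
rewrite big1 => [|i _]; last by rewrite IH ?mulr0 //= /bump /=; have := ltn_ord i; lia.
by rewrite addr0 => /esym/eqP; rewrite mulf_eq0 /= => /eqP.
Qed.

(** * The substitution of q^2 for q, carrying Jacobi's formula to f_2^3 *)

Definition subst_sq (x : series int) : series int :=
  Series (fun n => if odd n then 0 else coef x n./2).

Lemma sum_even (F : nat -> int) n :
  \sum_(i < n.*2.+1) (if odd i then 0 else F i./2) = \sum_(j < n.+1) F j.
Proof.
elim: n => [|n IH]; first by rewrite !big_ord_recr !big_ord0.
rewrite doubleS big_ord_recr big_ord_recr IH [RHS]big_ord_recr /=.
by rewrite odd_double /= addr0 doubleK.
Qed.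

Lemma subst_sqM x y : subst_sq (x * y) = subst_sq x * subst_sq y.
Proof.
apply: seriesP => n; rewrite [RHS]coefsM [LHS]/=; case: ifP => hn.
  rewrite big1 // => i _ /=; case: ifP => hi; first by rewrite mul0r.
  by rewrite ifT ?mulr0 // oddB ?hn ?hi // -ltnS.
have -> : n = n./2.*2 by rewrite -[LHS]odd_double_half hn.
rewrite doubleK -(sum_even (fun i => coef x i * coef y (n./2 - i))).
apply: eq_bigr => i _ /=; case: ifP => hi; first by rewrite mul0r.
rewrite ifF; last by rewrite oddB ?hi ?odd_double // -ltnS.
by congr (_ * coef y _); have := ltn_ord i; lia.
Qed.

Lemma subst_sqX x n : subst_sq (x ^+ n) = subst_sq x ^+ n.
Proof.
elim: n => [|n IH]; last by rewrite !exprS subst_sqM IH.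
by apply: seriesP => -[|[|m]] //=; case: ifP.
Qed.

Lemma subst_sq_eprod : subst_sq (eprod _ 1) = eprod _ 2.
Proof.
apply: eqm_all => N n nN /=.
have dprod m : subst_sq (prodq int 1 m) = prodq int 2 m.
  elim: m => [|m IH]; first by rewrite /prodq !big_geq //; apply: (subst_sqX 1 0).
  rewrite !prodqS subst_sqM IH mul1n; congr (_ * _); apply: seriesP => i.
  rewrite coefsB !coefs1 /= ; case: ifP => hi.
    case: eqP => h; first by rewrite h in hi. 
    by case: eqP => h'; rewrite ?subr0 //; move: hi; rewrite h' mul2n odd_double.
  have -> : (i == 0)%N = (i./2 == 0)%N by lia.
  by have -> : (i == 2 * m.+1)%N = (i./2 == m.+1)%N by lia.
rewrite -(dprod n) /=; case: ifP => // _.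
by rewrite (@coef_prodq _ 1 n./2 n) //; lia.
Qed.

Definition jac2 := th (fun i => 4 * i + 1) E_tri2.

Lemma subst_sq_jac : subst_sq jac = jac2.
Proof.
apply: seriesP => n; have -> : coef (subst_sq jac) n = if odd n then 0 else coef jac n./2 by [].
case: ifP => hn; first by rewrite /= big1 // => i /eqP; rewrite /E_tri2; lia.
have n2 : (n./2 <= n)%N by lia.
rewrite (coef_th_box _ dominated_tri n2) /=.
apply: eq_bigl => i; rewrite /E_tri /E_tri2; lia.
Qed.

Lemma jacobi2 : jac2 = eprod _ 2 ^+ 3.
Proof. by rewrite -subst_sq_jac jacobi subst_sqX subst_sq_eprod. Qed.

(** As phi(q) psi(q^2) = psi(q)^2, the right side is f_2^4/f_1^2 times f_1^2/f_2. This expresses the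
    logarithmic derivative of f_2 through Halphen's functions. *)
Lemma eprod2_cube : eprod _ 2 ^+ 3 = phi triv_sign * phi alt_sign * psi2.
Proof.
have c0 : coef (eprod int 1 ^+ 2) 0 = 1 by rewrite coefsX0 coef0_eprod expr1n.
have c1 : coef (eprod int 2) 0 = 1 by apply: coef0_eprod.
apply: (cancels c0); apply: (cancels c1).
transitivity ((psi triv_sign * psi triv_sign) * eprod _ 1 ^+ 2 * (phi alt_sign * eprod _ 2)).
  rewrite gauss_phi.
  transitivity ((psi triv_sign * eprod _ 1) ^+ 2 * eprod _ 1 ^+ 2); last by ring.
  by rewrite gauss_psi; ring.
by rewrite (psi_sqr is_sign_triv); ring.
Qed.

(** * Reduction modulo 7 *)

Notation K := (series 'F_7).

Definition red (x : series int) : K := Series (fun n => (coef x n)%:~R).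

Lemma coef_red x n : coef (red x) n = (coef x n)%:~R.
Proof. by []. Qed.

Lemma red_zmod : zmod_morphism red.
Proof. by move=> x y; apply: seriesP => n /=; rewrite rmorphB. Qed.
HB.instance Definition _ := GRing.isZmodMorphism.Build _ _ red red_zmod.
Lemma red_monoid : monoid_morphism red.
Proof.
split; first by apply: seriesP => n /=; case: (n == 0)%N.
move=> x y; apply: seriesP => n; rewrite coefsM /= rmorph_sum.
by apply: eq_bigr => i _; rewrite rmorphM.
Qed.
HB.instance Definition _ := GRing.isMonoidMorphism.Build _ _ red red_monoid.

Lemma red_theta x : red (theta x) = theta (red x).
Proof. by apply: seriesP => n /=; rewrite rmorphM rmorph_nat. Qed.
Lemma red_sX m : red (sX _ m) = sX _ m.
Proof. by apply: seriesP => n /=; case: (n == m)%N. Qed.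
Lemma coef0_red x : coef x 0 = 1 -> coef (red x) 0 = 1.
Proof. by rewrite /= => ->. Qed.

Lemma char7 : 7%:R = 0 :> K.
Proof. by apply: seriesP => n; rewrite coefs_nat [7%:R](_ : _ = 0) ?mul0rn //; apply/eqP. Qed.

(** Used with an explicit z: [ring] checks an identity with integer coefficients, and the multiple
    of 7 is dropped. *)
Lemma eq_mod7 (x y z : K) : x = y + 7%:R * z -> x = y.
Proof. by rewrite char7 mul0r addr0. Qed.

Lemma natr_mod7 n : (n %% 7)%:R = n%:R :> K.
Proof. by rewrite [in RHS](divn_eq n 7) natrD natrM char7 mulr0 add0r. Qed.

Lemma Fermat7 (a : 'F_7) : a != 0 -> a ^+ 6 = 1.
Proof. by move: a; case=> -[|[|[|[|[|[|[|//]]]]]]] i //= _; apply/eqP. Qed.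
Lemma Frob7 (a : 'F_7) : a ^+ 7 = a.
Proof.
have [->|a0] := eqVneq a 0; first by rewrite expr0n.
by rewrite exprS Fermat7 ?mulr1.
Qed.

(** Frobenius is additive and fixes F_7, so it acts as q -> q^7; x is first replaced by a polynomial
    agreeing with it up to q^n. *)
Lemma frob_series (x : K) n :
  coef (x ^+ 7) n = if (7 %| n)%N then coef x (n %/ 7) else 0.
Proof.
have ch : 7 \in [pchar K].
  by rewrite inE /= char7 eqxx.
have E N : eqm N.+1 x (\sum_(i < N.+1) cst (coef x i) * sX _ i).
  move=> j jN; rewrite coefs_sum (bigD1 (Ordinal jN)) // big1 => [|i].
    by rewrite -[RHS]/(_ + _) addr0 coefs_cstM /= eqxx mulr1.
  by rewrite -val_eqE coefs_cstM /= eq_sym => /negPf ->; rewrite mulr0.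
rewrite (eqmX 7 (@E n)) // -(pFrobenius_autE ch) rmorph_sum coefs_sum.
rewrite (eq_bigr (fun i : 'I_n.+1 => coef x i * (n == i * 7)%N%:R)) => [|i _]; last first.
  have c7 : cst (coef x i) ^+ 7 = cst (coef x i).
    by rewrite -[in RHS](Frob7 (coef x i)) !exprS !expr0 !cstM cst1.
  by rewrite -[X in coef X n = _]/((cst (coef x i) * sX _ i) ^+ 7) exprMn sXX c7 coefs_cstM.
case: ifP => [/dvdnP[m ->]|h].
  rewrite mulnK // (bigD1 (inord m)) // big1 => [|i].
    by rewrite -[LHS]/(_ + _) addr0 inordK ?eqxx ?mulr1 //; lia.
  rewrite -val_eqE /= inordK; last by lia.
  move=> im; have -> : (m * 7 == i * 7)%N = false by apply/eqP; move/eqP: im; lia.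
  by rewrite mulr0.
rewrite big1 // => i _; case: eqP; rewrite ?mulr0 // => ni.
by case/negP: (negbT h); apply/dvdnP; exists (i : nat).
Qed.

(** * Polynomials over F_7 evaluated at a series *)

Section Eval.
Variable t : K.
(** Polynomials are coefficient lists, constant term first, reduced modulo 7 by the operations, so
    that identities can be decided by computation. *)
Definition ev (p : seq nat) : K := foldr (fun a x => a%:R + t * x) 0 p.
Fixpoint addp (p q : seq nat) : seq nat :=
  match p, q with
  | [::], _ => q
  | _, [::] => p
  | a :: p', b :: q' => ((a + b) %% 7)%N :: addp p' q'
  end.
Definition sclp (c : nat) (p : seq nat) := [seq (c * a) %% 7 | a <- p]%N.
Fixpoint mulp (p q : seq nat) : seq nat :=
  if p is a :: p' then addp (sclp a q) (0%N :: mulp p' q) else [::].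
Fixpoint derp (p : seq nat) : seq nat :=
  if p is _ :: p' then addp p' (0%N :: derp p') else [::].
Definition expp (p : seq nat) n := iter n (mulp p) [:: 1%N].

(** Drops zero leading coefficients, so that results of different computations can be compared as
    lists. *)
Definition trimp (p : seq nat) :=
  foldr (fun a q => if (a == 0%N) && nilp q then [::] else a :: q) [::] p.
Lemma ev_cons a p : ev (a :: p) = a%:R + t * ev p. Proof. by []. Qed.
Lemma ev_trimp p : ev (trimp p) = ev p.
Proof.
elim: p => // a p IH; rewrite ev_cons -IH [trimp _]/= -/(trimp p).
by case: eqP => // ->; case: (trimp p); rewrite // add0r mulr0.
Qed.
Lemma ev_addp p q : ev (addp p q) = ev p + ev q.
Proof.
elim: p q => [|a p IH] [|b q] /=; rewrite ?add0r ?addr0 //.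
by rewrite natr_mod7 natrD; move: (IH q); rewrite /ev => ->; ring.
Qed.
Lemma ev_sclp c p : ev (sclp c p) = c%:R * ev p.
Proof.
elim: p => [|a p IH] /=; first by rewrite mulr0.
by rewrite natr_mod7 natrM; move: IH; rewrite /ev => ->; ring.
Qed.
Lemma ev_mulp p q : ev (mulp p q) = ev p * ev q.
Proof.
elim: p => [|a p IH] /=; first by rewrite mul0r.
by rewrite ev_addp ev_sclp /=; move: IH; rewrite /ev => ->; ring.
Qed.
Lemma ev_expp p n : ev (expp p n) = ev p ^+ n.
Proof.
elim: n => [|n IH]; first by rewrite /= mulr0 addr0.
by rewrite exprS -IH -ev_mulp.
Qed.
Lemma ev_derp p : theta (ev p) = theta t * ev (derp p).
Proof.
elim: p => [|a p IH] /=; first by rewrite theta0 mulr0.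
by rewrite thetaD theta_nat thetaM ev_addp /=; move: IH; rewrite /ev => ->; ring.
Qed.
End Eval.

(** * The differential field of level 2 modulo 7 *)

(** [mA], [mS] and [md] are symmetric in hA1 and hA3 and generate a ring closed under theta. *)
Definition mA : K := locked (red hA2).
Definition mS : K := locked (red (hA1 + hA3)).
Definition md : K := locked (red ((hA3 - hA1) ^+ 2)).
Definition f1 : K := locked (red (eprod _ 1)).
Definition f2 : K := locked (red (eprod _ 2)).
Definition mpsi : K := locked (red (psi triv_sign)).

Lemma coef0_f1 : coef f1 0 = 1.
Proof. by rewrite /f1 -lock; apply/coef0_red/coef0_eprod. Qed.
Lemma coef0_f2 : coef f2 0 = 1.
Proof. by rewrite /f2 -lock; apply/coef0_red/coef0_eprod. Qed.
Lemma coef0_mpsi : coef mpsi 0 = 1.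
Proof. by rewrite /mpsi -lock; apply/coef0_red/coef0_psi/is_sign_triv. Qed.

(** hA1 hA3 = ((hA1 + hA3)^2 - (hA3 - hA1)^2)/4, and 1/4 = 2 modulo 7. *)
Lemma theta_mS : theta mS = 2%:R * mS ^+ 2 - 2%:R * md.
Proof.
rewrite /mS /md -!lock -red_theta (halphen_psi is_sign_triv) -/hA1.
apply: (@eq_mod7 _ _ (- red (hA1 * hA3))); rewrite !(rmorphXn, rmorphB, rmorphD, rmorphM) /=.
ring.
Qed.

(** The two Halphen equations containing hA2 minus the third give 2 theta hA2; then 1/2 = 4 modulo
    7. *)
Lemma theta_mA : theta mA = 4%:R * (mA * mS - (2%:R * mS ^+ 2 - 2%:R * md)).
Proof.
have h : 2%:R * theta mA = mA * mS - theta mS.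
  rewrite /mA /mS -!lock -!red_theta -rmorphM -rmorphB /= -(rmorph_nat red) -rmorphM.
  congr (red _); move: (halphen_psi is_sign_triv) halphen_phi (halphen_psi is_sign_alt); rewrite -/hA1 -/hA2 !thetaD => h1 h2 h3.
  transitivity ((theta hA1 + theta hA2) + (theta hA2 + theta hA3) - (theta hA1 + theta hA3)).
    by ring.
  by rewrite h1 h2 h3; ring.
apply: (@eq_mod7 _ _ (- theta mA)); rewrite -theta_mS -h; ring.
Qed.

Lemma theta_md : theta md = 2%:R * mA * md.
Proof.
rewrite /mA /md -!lock -red_theta thetaX halphen_sub31 /= expr1.
rewrite !(rmorphXn, rmorphB, rmorphD, rmorphM, rmorph_nat) /=.
ring.
Qed.

(* ms and me are the reductions of E_2(q^2) and 2 E_2(q^2) - E_2(q). *)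
Definition ms : K := locked (mS + mA).
Definition me : K := locked (mS - 2%:R * mA).

Lemma coef0_me : coef me 0 = 1.
Proof.
rewrite /me /mS /mA -!lock coefsB coefs_natM.
by rewrite !coef_red coefsD !coef_hA0 coef_hA30 add0r mulr0 subr0.
Qed.

Lemma theta_f2cube : 4%:R * theta (f2 ^+ 3) + f2 ^+ 3 = ms * f2 ^+ 3.
Proof.
rewrite /f2 /ms /mS /mA -!lock -rmorphXn -red_theta -(rmorph_nat red) -!(rmorphD, rmorphM) /=.
congr (red _); rewrite eprod2_cube !thetaM.
have h1 := theta_phi is_sign_triv; have h2 := theta_phi is_sign_alt.
have h3 := theta_psi2.
set u := phi triv_sign in h1 *; set v := phi alt_sign in h2 *.
transitivity ((4%:R * theta u) * v * psi2 + u * (4%:R * theta v) * psi2 + u * v * (4%:R * theta psi2) + u * v * psi2).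
  by ring.
by rewrite h1 h2 h3 -/hA1 -/hA2; ring.
Qed.

(** By Jacobi's formula Y multiplies the weight a = 4i + 1 by a^2, so three applications turn a into
    a^7 = a. *)
Lemma f2cube_ode : let Y (x : K) := 4%:R * theta x + x in
  Y (Y (Y (f2 ^+ 3))) = f2 ^+ 3.
Proof.
rewrite /= /f2 -!lock -rmorphXn /= -jacobi2.
have Y1 x : 4%:R * theta (red x) + red x = red (4%:R * theta x + x).
  by rewrite rmorphD rmorphM rmorph_nat /= red_theta.
rewrite !Y1 !W_tri2; apply: seriesP => n /=; rewrite !rmorph_sum; apply: eq_bigr => i _.
rewrite -[RHS]Frob7 -rmorphXn /=; congr (_%:~R); ring.
Qed.

(* This is the congruence E_6(q^2) = 1 modulo 7. *)
Lemma level1_relation : me * (2%:R * md - me ^+ 2) = 1.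
Proof.
have h := f2cube_ode; rewrite /= theta_f2cube in h.
(* Dividing by f_2^3 turns Y into 4 theta + ms; the equation becomes (4 theta + ms)^2 ms = 1, a
   polynomial relation between the generators. *)
have Y1 x : 4%:R * theta (x * f2 ^+ 3) + x * f2 ^+ 3 = (4%:R * theta x + ms * x) * f2 ^+ 3.
  rewrite thetaM mulrDr -addrA.
  have -> : 4%:R * (x * theta (f2 ^+ 3)) + x * f2 ^+ 3 = x * (4%:R * theta (f2 ^+ 3) + f2 ^+ 3).
    by ring.
  by rewrite theta_f2cube; ring.
rewrite !Y1 -[in RHS](mul1r (f2 ^+ 3)) mulrC [RHS]mulrC in h.
move/cancels: h; rewrite coefsX0 coef0_f2 expr1n => /(_ erefl) h.
rewrite -[RHS]h.
have s1 : theta ms = (2%:R * mS ^+ 2 - 2%:R * md) + 4%:R * (mA * mS - (2%:R * mS ^+ 2 - 2%:R * md)).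
  by rewrite /ms -lock thetaD theta_mS theta_mA.
rewrite !(thetaD, thetaM, theta_nat) s1 !(thetaD, thetaN, thetaM, thetaX, theta_nat, theta_mS, theta_mA, theta_md) /= /ms /me -!lock.
symmetry; clear h.
apply: (@eq_mod7 _ _ (- 138%:R * mS ^+ 3 + 51%:R * mA ^+ 1 * mS ^+ 2 + 9%:R * mA ^+ 2 * mS ^+ 1 - 1%:R * mA ^+ 3 + 138%:R * mS ^+ 1 * md ^+ 1 + 20%:R * mA ^+ 1 * md ^+ 1)).
ring.
Qed.

Definition mk : K := locked (invs me).
Lemma mekK : me * mk = 1.
Proof. by rewrite /mk -lock mulsV ?coef0_me. Qed.
Lemma mkE : mk = 2%:R * md - me ^+ 2.
Proof. by apply: (cancels coef0_me); rewrite mekK level1_relation. Qed.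

Lemma mAE : mA = 5%:R * (ms - me).
Proof. by apply: (@eq_mod7 _ _ (- 2%:R * mA)); rewrite /ms /me -!lock; ring. Qed.
Lemma mSE : mS = 3%:R * ms + 5%:R * me.
Proof. by apply: (@eq_mod7 _ _ (mA - mS)); rewrite /ms /me -!lock; ring. Qed.
Lemma mdE : md = 4%:R * (me ^+ 2 + mk).
Proof. by apply: (@eq_mod7 _ _ (- md)); rewrite mkE; ring. Qed.

Lemma theta_me0 : theta me = (2%:R * mS ^+ 2 - 2%:R * md) -
  8%:R * (mA * mS - (2%:R * mS ^+ 2 - 2%:R * md)).
Proof.
rewrite /me -lock thetaD thetaN thetaM theta_nat theta_mS theta_mA; ring.
Qed.

Lemma theta_mk : theta mk = - (mk ^+ 2 * theta me).
Proof.
have := congr1 (@theta _) mekK; rewrite thetaM theta1 => h.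
transitivity (mk * (theta me * mk + me * theta mk) - mk ^+ 2 * theta me + (1 - me * mk) * theta mk).
  by ring.
by rewrite h mekK; ring.
Qed.

(** Computing theta mk once from mk = 1/me and once from [mkE] yields a second relation, which can
    be solved for ms modulo 7. *)
Lemma msE : ms = 4%:R * me ^+ 4 + 2%:R * me + 2%:R * mk ^+ 2.
Proof.
have hEQ : (2%:R * me - mk ^+ 2) * theta me - 4%:R * mA * md = 0.
  have := theta_mk; rewrite {1}mkE !(thetaD, thetaN, thetaM, thetaX, theta_nat, theta_md) /= => h.
  transitivity (- (0 * md + 2%:R * (2%:R * mA * md) - 2%:R * me ^+ 1 * theta me) - mk ^+ 2 * theta me).
    by ring.
  by rewrite h; ring.
rewrite theta_me0 mdE mAE mSE in hEQ.
have hek : me * mk - 1 = 0 by rewrite mekK subrr.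
move: hEQ hek; move: ms me mk => s e k; set EQ := (X in X = 0) => hEQ; set H := (X in X = 0) => hek.
(* Modulo 7 and e k = 1, [EQ] is linear in s with coefficient -k, whence the multiplier 6 e = -e;
   [W] and [Z] are the cofactors of e k - 1 and 7. *)
pose W := 3852%:R * e ^+ 1 + 252%:R * s ^+ 2 * k ^+ 1 + 2760%:R * s ^+ 1 * e ^+ 1 * k ^+ 1 + 3468%:R * e ^+ 2 * k ^+ 1 - 432%:R * k ^+ 2 + 3240%:R * s ^+ 1.
pose Z := 463%:R * s ^+ 1 - 1060%:R * e ^+ 4 + 550%:R * e ^+ 1 - 62%:R * k ^+ 2 - 72%:R * s ^+ 2 * e ^+ 2 - 720%:R * s ^+ 1 * e ^+ 3 + 36%:R * s ^+ 2 * k ^+ 1.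
apply: (@eq_mod7 _ _ Z).
transitivity (4%:R * e ^+ 4 + 2%:R * e + 2%:R * k ^+ 2 + 7%:R * Z + 6%:R * e * EQ + H * W).
  by rewrite /EQ /H /W /Z; ring.
by rewrite hEQ hek; ring.
Qed.

Lemma theta_me : theta me = mk * (1 - me ^+ 6).
Proof.
rewrite theta_me0 mdE mAE mSE msE.
have hek : me * mk - 1 = 0 by rewrite mekK subrr.
move: hek; move: me mk => e k; set H := (X in X = 0) => hek.
pose W := 672%:R * e ^+ 3 * k ^+ 1 + 1256%:R * k ^+ 1 + 1%:R * e ^+ 5 + 672%:R * e ^+ 2.
pose Z := 96%:R * e ^+ 8 + 359%:R * e ^+ 5 + 334%:R * e ^+ 2 + 24%:R * k ^+ 4 + 169%:R * k ^+ 1.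
apply: (@eq_mod7 _ _ Z).
transitivity (k * (1 - e ^+ 6) + 7%:R * Z + H * W).
  by rewrite /H /W /Z; ring.
by rewrite hek; ring.
Qed.

(** * Iterated derivatives as polynomials in t *)

Definition mt : K := locked (me ^+ 3).
Notation evt := (ev mt).

Lemma mtE : mt = me ^+ 3. Proof. by rewrite /mt -lock. Qed.

Lemma mt_mk2 : mt * mk ^+ 2 = me.
Proof.
rewrite mtE; transitivity (me * (me * mk) ^+ 2); first by ring.
by rewrite mekK expr1n mulr1.
Qed.

Lemma evX : evt [:: 0; 1] = mt.
Proof. by rewrite /=; ring. Qed.
Lemma ev1 : evt [:: 1] = 1.
Proof. by rewrite /=; ring. Qed.

Definition pS : seq nat := [:: 2; 2; 4].
Definition pG : seq nat := [:: 1; 0; 6].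

Lemma evS : ms = mk ^+ 2 * evt pS.
Proof.
rewrite msE /=.
transitivity (4%:R * (me ^+ 3) * (mt * mk ^+ 2) + 2%:R * (mt * mk ^+ 2) + 2%:R * mk ^+ 2).
  by rewrite mt_mk2; ring.
by rewrite -mtE; ring.
Qed.

Lemma evG : theta me = mk * evt pG.
Proof.
rewrite theta_me; apply: (@eq_mod7 _ _ (- mk * mt ^+ 2)); rewrite /= mtE; ring.
Qed.

Lemma theta_mt : theta mt = 3%:R * mk ^+ 2 * mt * evt pG.
Proof.
rewrite {1}mtE thetaX evG -[3.-1]/2%N.
transitivity (3%:R * me * (me * mk) * evt pG); first by ring.
rewrite mekK mulr1; transitivity (3%:R * (mt * mk ^+ 2) * evt pG); last by ring.
by rewrite mt_mk2.
Qed.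

Lemma theta_mkX a : theta (mk ^+ a) = - (a%:R * mk ^+ a.+2 * evt pG).
Proof.
rewrite thetaX theta_mk evG; case: a => [|a]; first by rewrite !mul0r oppr0.
by rewrite -[a.+1.-1]/a !exprS; ring.
Qed.

(** The coefficient of q^n is multiplied by n + c. Modulo 7 this kills the class of -c, and the
    sixth iterate is the projection onto the other classes. *)
Definition Dop (c : nat) (x : K) : K := theta x + c%:R * x.

(* Applied to F * mk^a * p(t), where (theta + c) F = mk^2 L(t) F, the operator
   theta + c gives F * mk^(a+2) * (step L a p)(t). *)
Definition step (L : seq nat) (a : nat) (p : seq nat) : seq nat :=
  addp (mulp L p) (addp (sclp (6 * a) (mulp pG p)) (sclp 3 (0%N :: mulp pG (derp p)))).

Fixpoint steps (L : seq nat) (a : nat) (p : seq nat) (n : nat) : seq nat :=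
  if n is n'.+1 then steps L a.+2 (step L a p) n' else p.

Lemma Dop_step c L F a p : Dop c F = mk ^+ 2 * evt L * F ->
  Dop c (F * (mk ^+ a * evt p)) = F * (mk ^+ a.+2 * evt (step L a p)).
Proof.
rewrite /Dop => h; rewrite !thetaM theta_mkX ev_derp theta_mt.
have -> : theta F = mk ^+ 2 * evt L * F - c%:R * F by rewrite -h; ring.
rewrite /step !ev_addp !ev_sclp ev_cons !ev_mulp.
apply: (@eq_mod7 _ _ (- (F * a%:R * mk ^+ a.+2 * evt pG * evt p))).
rewrite natrM !exprS; ring.
Qed.

Lemma iter_Dop c L F a p n : Dop c F = mk ^+ 2 * evt L * F ->
  iter n (Dop c) (F * (mk ^+ a * evt p)) =
  F * (mk ^+ (a + n.*2) * evt (steps L a p n)).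
Proof.
move=> h; elim: n a p => [|n IH] a p; first by rewrite addn0.
by rewrite iterSr (Dop_step _ _ h) IH doubleS !addnS.
Qed.

Lemma coef_Dop c x m : coef (Dop c x) m = (m + c)%:R * coef x m.
Proof. by rewrite coefsD coefs_natM natrD mulrDl. Qed.

Lemma F7_nat0 n : (7 %| n)%N -> n%:R = 0 :> 'F_7.
Proof. by move=> /dvdnP[m ->]; rewrite natrM [X in _ * X](_ : _ = 0) ?mulr0 //; apply/eqP. Qed.

Lemma coef_Dop0 c x m : (7 %| m + c)%N -> coef (Dop c x) m = 0.
Proof. by move=> h; rewrite coef_Dop F7_nat0 // mul0r. Qed.

Lemma coef_iter_fixed c x m n : iter n.+1 (Dop c) x = x -> (7 %| m + c)%N ->
  coef x m = 0.
Proof. by move=> <-; apply: coef_Dop0. Qed.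

Lemma DopM c x y : theta y = 0 -> Dop c (x * y) = Dop c x * y.
Proof. by rewrite /Dop thetaM => ->; ring. Qed.

Lemma theta_X7 (x : K) : theta (x ^+ 7) = 0.
Proof. by rewrite thetaX char7 !mul0r. Qed.

(** * Logarithmic derivatives of the products *)

Lemma theta_mpsi : theta mpsi = (mS - 1) * mpsi.
Proof.
have h : 8%:R * theta mpsi = (mS - 1) * mpsi.
  rewrite /mpsi /mS -!lock -red_theta -(rmorph_nat red) -rmorphM /=.
  by rewrite (theta_psi is_sign_triv) !(rmorphM, rmorphB) rmorph1.
by rewrite -h; apply: (@eq_mod7 _ _ (- theta mpsi)); ring.
Qed.

(** [theta_f2cube] says 12 theta f_2 = (ms - 1) f_2, and 1/12 = 3 modulo 7. *)
Lemma theta_f2 : theta f2 = 3%:R * (ms - 1) * f2.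
Proof.
have h : 12%:R * theta f2 = (ms - 1) * f2.
  have c0 : coef (f2 ^+ 2) 0 = 1 by rewrite coefsX0 coef0_f2 expr1n.
  apply: (cancels c0).
  transitivity (4%:R * theta (f2 ^+ 3) + f2 ^+ 3 - f2 ^+ 3).
    by rewrite thetaX /=; ring.
  by rewrite theta_f2cube; ring.
rewrite -mulrA -h; apply: (@eq_mod7 _ _ (- 5%:R * theta f2)); ring.
Qed.

Definition i1 : K := locked (invs f1).
Definition i2 : K := locked (invs f2).
Lemma f1i1 : f1 * i1 = 1. Proof. by rewrite /i1 -lock mulsV ?coef0_f1. Qed.
Lemma f2i2 : f2 * i2 = 1. Proof. by rewrite /i2 -lock mulsV ?coef0_f2. Qed.

Lemma theta_i2 : theta i2 = - (3%:R * (ms - 1)) * i2.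
Proof.
have := congr1 (@theta _) f2i2; rewrite thetaM theta1 theta_f2 => h.
apply: (cancels coef0_f2).
transitivity (3%:R * (ms - 1) * f2 * i2 + f2 * theta i2 - 3%:R * (ms - 1) * f2 * i2).
  by ring.
by rewrite h; ring.
Qed.

Lemma mpsi_f1 : mpsi * f1 = f2 ^+ 2.
Proof. by rewrite /mpsi /f1 /f2 -!lock -rmorphM gauss_psi rmorphXn. Qed.
Lemma mpsiE : mpsi = f2 ^+ 2 * i1.
Proof. by rewrite -mpsi_f1 -mulrA f1i1 mulr1. Qed.

Lemma theta_f1 : theta f1 = (6%:R * (ms - 1) - (mS - 1)) * f1.
Proof.
apply: (cancels coef0_mpsi).
have := congr1 (@theta _) mpsi_f1; rewrite thetaM thetaX theta_mpsi theta_f2 /= => h.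
transitivity ((mS - 1) * mpsi * f1 + mpsi * theta f1 - (mS - 1) * (mpsi * f1)).
  by ring.
transitivity (6%:R * (ms - 1) * (f2 ^+ 2) - (mS - 1) * (mpsi * f1)).
  by rewrite h; ring.
by rewrite -mpsi_f1; ring.
Qed.

(** * Vanishing residue classes from equations (theta + c)^6 x = x *)

Definition mF : K := locked (mpsi * f2 ^+ 3).

(** The shift 3 cancels modulo 7 the constant in the logarithmic derivative mS + 9 ms - 10; the
    shifts 4 and 2 below are found the same way. *)
Lemma DF : Dop 3 mF = mk ^+ 2 * evt [:: 3; 1; 6] * mF.
Proof.
have -> : mk ^+ 2 * evt [:: 3; 1; 6] = 5%:R * (ms + me).
  rewrite evS -mt_mk2 /=.
  by apply: (@eq_mod7 _ _ (- mk ^+ 2 * (1 + 2%:R * mt + 2%:R * mt ^+ 2))); ring.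
rewrite /Dop /mF -lock thetaM thetaX theta_mpsi theta_f2 mSE /=.
apply: (@eq_mod7 _ _ (mpsi * f2 ^+ 3 * (ms - 1))); ring.
Qed.

Lemma Di2 : Dop 4 i2 = mk ^+ 2 * evt [:: 1; 1; 2] * i2.
Proof.
have -> : mk ^+ 2 * evt [:: 1; 1; 2] = 4%:R * ms.
  rewrite evS /=.
  by apply: (@eq_mod7 _ _ (- mk ^+ 2 * (1 + mt + 2%:R * mt ^+ 2))); ring.
rewrite /Dop theta_i2.
apply: (@eq_mod7 _ _ (i2 * (1 - ms))); ring.
Qed.

(** f_1^9 f_2^2 e is f_1^7 times [mu * me], and f_1^7 is a series in q^7 modulo 7. *)
Definition mu : K := locked (f1 ^+ 2 * f2 ^+ 2).

Lemma Dmu : Dop 2 mu = mk ^+ 2 * evt [:: 3; 0; 6] * mu.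
Proof.
have -> : mk ^+ 2 * evt [:: 3; 0; 6] = 5%:R * ms + 4%:R * me.
  rewrite evS -mt_mk2 /=.
  by apply: (@eq_mod7 _ _ (- mk ^+ 2 * (1 + 2%:R * mt + 2%:R * mt ^+ 2))); ring.
rewrite /Dop /mu -lock thetaM !thetaX theta_f1 theta_f2 mSE /=.
apply: (@eq_mod7 _ _ (f1 ^+ 2 * f2 ^+ 2 * (ms - 2%:R * me - 2%:R))); ring.
Qed.

Lemma mk_mt n : mk ^+ (3 * n) * mt ^+ n = 1.
Proof.
rewrite mtE -exprM -exprMn.
by rewrite mulrC mekK expr1n.
Qed.

Lemma ev_monom n : evt (ncons n 0%N [:: 1%N]) = mt ^+ n.
Proof.
elim: n => [|n IH]; first by rewrite /=; ring.
by rewrite [ncons _ _ _]/= ev_cons IH exprS add0r.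
Qed.

(** Six steps produce mk^12 t^4, which is 1. Hence F vanishes modulo 7 on the class 4. *)
Lemma mF_fixed : iter 6 (Dop 3) mF = mF.
Proof.
have := @iter_Dop 3 _ mF 0 [:: 1%N] 6 DF.
rewrite ev1 expr0 !mulr1 => ->.
rewrite -ev_trimp; have -> : trimp (steps [:: 3; 1; 6] 0 [:: 1%N] 6) = ncons 4 0%N [:: 1%N] by vm_compute.
by rewrite ev_monom (mk_mt 4) mulr1.
Qed.

Lemma i2_fixed : iter 6 (Dop 4) i2 = i2.
Proof.
have := @iter_Dop 4 _ i2 0 [:: 1%N] 6 Di2.
rewrite ev1 expr0 !mulr1 => ->.
rewrite -ev_trimp; have -> : trimp (steps [:: 1; 1; 2] 0 [:: 1%N] 6) = ncons 4 0%N [:: 1%N] by vm_compute.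
by rewrite ev_monom (mk_mt 4) mulr1.
Qed.

Lemma mue_fixed : iter 6 (Dop 2) (mu * me) = mu * me.
Proof.
(* me is entered as mk^2 t, and the outcome mk^14 t^5 is me again. *)
have := @iter_Dop 2 _ mu 2 [:: 0; 1]%N 6 Dmu.
rewrite evX [mk ^+ 2 * mt]mulrC mt_mk2 => ->.
rewrite -ev_trimp; have -> : trimp (steps [:: 3; 0; 6] 2 [:: 0; 1]%N 6) = ncons 5 0%N [:: 1%N] by vm_compute.
rewrite ev_monom; transitivity (mu * ((mk ^+ (3 * 4) * mt ^+ 4) * (mt * mk ^+ 2))).
  by rewrite -[(2 + 6.*2)%N]/(3 * 4 + 2)%N exprD; ring.
by rewrite mk_mt mt_mk2 mul1r.
Qed.

(** * The Hauptmodul in terms of products *)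

Lemma me2E : me ^+ 2 = mt * mk.
Proof.
rewrite mtE; transitivity (me ^+ 2 * (me * mk)); last by ring.
by rewrite mekK mulr1.
Qed.

Lemma mX_prod : (f1 ^+ 2 * i2) ^+ 8 = mk * evt [:: 4; 4]%N.
Proof.
transitivity md; last by rewrite mdE me2E /=; ring.
have -> : f1 ^+ 2 * i2 = red (phi alt_sign).
  rewrite /f1 -lock -rmorphXn -gauss_phi rmorphM -mulrA.
  by have := f2i2; rewrite {1}/f2 -lock => ->; rewrite mulr1.
rewrite /md -lock phi_alt4 !rmorphXn; ring.
Qed.

(** By [psi8], since 4 (hA3 - hA2)(hA1 - hA2) reduces to me^2 - md. *)
Lemma mY_prod : sX _ 1 * (f2 ^+ 2 * i1) ^+ 8 = mk * evt [:: 3; 4]%N.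
Proof.
have h : 2%:R * (sX _ 1 * (f2 ^+ 2 * i1) ^+ 8) = red ((hA3 - hA2) * (hA1 - hA2)).
  rewrite psi8 -mpsiE /mpsi -lock -red_sX !(rmorphM, rmorphXn, rmorph_nat) /=.
  by apply: (@eq_mod7 _ _ (- 2%:R * (red (sX _ 1) * red (psi triv_sign) ^+ 8))); ring.
have h4 : 8%:R * (sX _ 1 * (f2 ^+ 2 * i1) ^+ 8) = me ^+ 2 - md.
  transitivity (4%:R * (2%:R * (sX 'F_7 1 * (f2 ^+ 2 * i1) ^+ 8))); first by ring.
  rewrite h /me /mS /mA /md -!lock -(rmorph_nat red 4) -(rmorph_nat red 2).
  rewrite -!(rmorphM, rmorphB, rmorphXn) /=; congr (red _); ring.
apply: (@eq_mod7 _ _ (- (sX _ 1 * (f2 ^+ 2 * i1) ^+ 8) - mk - mk * mt)).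
transitivity (8%:R * (sX 'F_7 1 * (f2 ^+ 2 * i1) ^+ 8) - 7%:R * (sX 'F_7 1 * (f2 ^+ 2 * i1) ^+ 8)).
  by ring.
by rewrite h4 mdE me2E /=; ring.
Qed.

Definition Wpoly : seq nat := mulp pS (steps [:: 3; 1; 6] 0 [:: 1%N] 5).

Lemma ms_D5F : ms * iter 5 (Dop 3) mF = mF * (mk ^+ 12 * evt Wpoly).
Proof.
have := @iter_Dop 3 _ mF 0 [:: 1%N] 5 DF.
rewrite ev1 expr0 !mulr1 => ->.
by rewrite {1}evS /Wpoly ev_mulp -[(0 + 5.*2)%N]/10%N; ring.
Qed.

(* The Hecke operator T_7 applied to F E_6(q^2), divided by 7, is a combination
   of F(q^7) and f1^9 f2^3 e. *)
Lemma Wpoly_residue X Y : X = mk * evt [:: 4; 4]%N -> Y = mk * evt [:: 3; 4]%N ->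
  ms * iter 5 (Dop 3) mF - iter 6 (Dop 3) (ms * iter 5 (Dop 3) mF) =
  mF * (X ^+ 6 * Y ^+ 18 + 3%:R * (X ^+ 6 * Y ^+ 4 * me ^+ 7)).
Proof.
move=> XE YE; apply: (etrans (congr1 (fun x => x - iter 6 (Dop 3) x) ms_D5F)).
rewrite XE YE; clear X Y XE YE.
have -> : iter 6 (Dop 3) (mF * (mk ^+ 12 * evt Wpoly)) =
    mF * (mk ^+ 24 * evt (steps [:: 3; 1; 6] 12 Wpoly 6)).
  exact: (@iter_Dop 3 _ mF 12 Wpoly 6 DF).
(* All terms are given the factor mk^24, using mk^12 = mk^24 t^4 and me^7 = mk^14 t^7; a polynomial
   identity in t remains. *)
pose p1 := mulp (expp [:: 4; 4]%N 6) (expp [:: 3; 4]%N 18).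
pose p2 := mulp (expp [:: 4; 4]%N 6) (mulp (expp [:: 3; 4]%N 4) (ncons 7 0%N [:: 1%N])).
have poly_id : evt (addp (mulp (ncons 4 0%N [:: 1%N]) Wpoly)
    (sclp 6 (steps [:: 3; 1; 6] 12 Wpoly 6))) = evt (addp p1 (sclp 3 p2)).
  rewrite -ev_trimp -[RHS]ev_trimp.
  have -> : trimp (addp (mulp (ncons 4 0%N [:: 1%N]) Wpoly)
    (sclp 6 (steps [:: 3; 1; 6] 12 Wpoly 6))) = trimp (addp p1 (sclp 3 p2)) by vm_compute.
  by [].
have e1 : evt p1 = evt [:: 4; 4]%N ^+ 6 * evt [:: 3; 4]%N ^+ 18.
  by rewrite /p1 ev_mulp !ev_expp.
have e2 : evt p2 = evt [:: 4; 4]%N ^+ 6 * (evt [:: 3; 4]%N ^+ 4 * mt ^+ 7).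
  by rewrite /p2 ev_mulp ev_expp ev_mulp ev_expp ev_monom.
have k1 : mk ^+ 12 * mt ^+ 4 = 1 := mk_mt 4.
have k2 : me ^+ 7 = mk ^+ 14 * mt ^+ 7 by rewrite -mt_mk2 exprMn -exprM mulrC.
rewrite ev_addp ev_mulp ev_monom ev_sclp ev_addp ev_sclp e1 e2 in poly_id.
rewrite k2; move: (evt (steps _ _ _ _)) (evt Wpoly) (evt [:: 4; 4]%N) (evt [:: 3; 4]%N) poly_id k1.
clear; move: mF mk mt => F k t w12 w6 x y h hk.
transitivity (F * (k ^+ 24 * (x ^+ 6 * y ^+ 18 + 3%:R * (x ^+ 6 * (y ^+ 4 * t ^+ 7))))); last by ring.
rewrite -h; apply: (@eq_mod7 _ _ (- F * k ^+ 24 * w12)).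
transitivity (F * k ^+ 12 * w6 * (k ^+ 12 * t ^+ 4) - F * k ^+ 24 * w12); last by ring.
apply: (etrans _ (esym (congr1 (fun a => F * k ^+ 12 * w6 * a - F * k ^+ 24 * w12) hk))).
ring.
Qed.

(** The exponents 6, 18 and 4 make each term, times F/f_2^7, a power of q times a seventh power, to
    which [frob_series] applies. *)
Lemma residue_products :
  mF * (((f1 ^+ 2 * i2) ^+ 8) ^+ 6 * (sX _ 1 * (f2 ^+ 2 * i1) ^+ 8) ^+ 18 +
  3%:R * (((f1 ^+ 2 * i2) ^+ 8) ^+ 6 * (sX _ 1 * (f2 ^+ 2 * i1) ^+ 8) ^+ 4 * me ^+ 7))
   * i2 ^+ 7 =
  sX _ 18 * (mF ^+ 7 * i2) ^+ 7 + 3%:R * (sX _ 4 * (f1 ^+ 7 * (mu * me)) ^+ 7).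
Proof.
have -> : mF = f2 ^+ 5 * i1 by rewrite /mF -lock mpsiE; ring.
have -> : sX 'F_7 18 = sX _ 1 ^+ 18 by rewrite sXX.
have -> : sX 'F_7 4 = sX _ 1 ^+ 4 by rewrite sXX.
rewrite /mu -lock; move: f1i1 f2i2; move: f1 f2 i1 i2 me (sX _ 1) => a b c d e x ac bd.
transitivity (x ^+ 18 * b ^+ 245 * c ^+ 49 * d ^+ 7 * (b * d) ^+ 48 * (a * c) ^+ 96 +
  3%:R * x ^+ 4 * a ^+ 63 * b ^+ 14 * e ^+ 7 * (a * c) ^+ 33 * (b * d) ^+ 55).
  by ring.
by rewrite ac bd !expr1n; ring.
Qed.

Lemma coef_i2_0 m : (m %% 7 = 3)%N -> coef i2 m = 0.
Proof. by move=> h; apply: (coef_iter_fixed i2_fixed); lia. Qed.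
Lemma coef_mue_0 m : (m %% 7 = 5)%N -> coef (mu * me) m = 0.
Proof. by move=> h; apply: (coef_iter_fixed mue_fixed); lia. Qed.

Lemma coef_7powM (x y : K) r : (forall m, (m %% 7 = r)%N -> coef y m = 0) ->
  forall m, (m %% 7 = r)%N -> coef (x ^+ 7 * y) m = 0.
Proof.
move=> hy m hm; rewrite coefsM big1 // => i _; rewrite frob_series.
case: ifP => h; last by rewrite mul0r.
by rewrite hy ?mulr0 //; have := ltn_ord i; lia.
Qed.

(** Integration by parts: (theta + 3)(Z5 V) = F V + Z5 theta V for Z5 = (theta + 3)^5 F, and the
    left side vanishes on the class 4 modulo 7, so only the known theta V enters. *)
Lemma coef_mF_V (V z : K) m : (m %% 49 = 39)%N ->
  theta V = - (3%:R * (ms - 1)) * i2 ^+ 7 - z -> theta z = 0 ->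
  coef (mF * V) m = 0.
Proof.
move=> hm hV hz; have m7 : (7 %| m + 3)%N by lia.
pose Z5 := iter 5 (Dop 3) mF; pose Z4 := iter 4 (Dop 3) mF.
have Z5E : Z5 = Dop 3 Z4 by [].
have hD : Dop 3 (Z5 * V) = mF * V + Z5 * theta V.
  by rewrite -[in RHS]mF_fixed iterS -/Z5 /Dop thetaM; ring.
have := coef_Dop0 (Z5 * V) m7; rewrite hD hV.
(* Factors killed by theta pass through theta + 3, so all of Z5 theta V except the projection
   treated in [Wpoly_residue] lies in the image of theta + 3. *)
have -> : mF * V + Z5 * (- (3%:R * (ms - 1)) * i2 ^+ 7 - z) =
  mF * V + Dop 3 (3%:R * (Z4 * i2 ^+ 7) - Z4 * z - 3%:R * (iter 5 (Dop 3) (ms * Z5) * i2 ^+ 7))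
  - 3%:R * ((ms * Z5 - iter 6 (Dop 3) (ms * Z5)) * i2 ^+ 7).
  set U := iter 5 (Dop 3) (ms * Z5); have -> : iter 6 (Dop 3) (ms * Z5) = Dop 3 U by [].
  have DB x y : Dop 3 (x - y) = Dop 3 x - Dop 3 y by rewrite /Dop thetaD thetaN; ring.
  have Dn x : Dop 3 (3%:R * x) = 3%:R * Dop 3 x by rewrite /Dop theta_natM; ring.
  rewrite !DB !Dn !(DopM _ _ (theta_X7 _)) (DopM _ _ hz) -Z5E; ring.
rewrite coefsB coefsD (coef_Dop0 _ m7) addr0 coefs_natM (Wpoly_residue mX_prod mY_prod) residue_products.
(* For m = 39 + 49k, (m - 18)/7 = 3 + 7k and (m - 4)/7 = 5 + 7k: the classes where 1/f_2 and mu e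
   vanish. *)
rewrite coefsD coefs_natM !coefs_sXM !ifT; try by lia.
rewrite !frob_series !ifT; try by lia.
rewrite (@coef_7powM _ _ _ coef_i2_0) ?(@coef_7powM _ _ _ coef_mue_0) ?mulr0 ?addr0 ?mulr0 ?subr0 //; lia.
Qed.

(** * Lifting to congruences modulo 49 *)

Definition supp7 (x : series int) := forall n, ~~ (7 %| n)%N -> coef x n = 0.

Lemma supp7M x y : supp7 x -> supp7 y -> supp7 (x * y).
Proof.
move=> hx hy n hn; rewrite coefsM big1 // => i _.
case: (boolP (7 %| i)%N) => hi; last by rewrite hx ?mul0r.
by rewrite hy ?mulr0 //; have := ltn_ord i; lia.
Qed.

Lemma supp7_prodq N : supp7 (prodq _ 14 N).
Proof.
elim: N => [|N IH]; first by move=> [|n] //; rewrite /prodq big_geq.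
rewrite prodqS; apply: supp7M => // n hn; rewrite coefsB /=.
have -> : (n == 0)%N = false by apply/eqP; lia.
by have -> : (n == 14 * N.+1)%N = false by apply/eqP; lia.
Qed.

Lemma supp7_eprod : supp7 (eprod _ 14).
Proof. by move=> n; apply: supp7_prodq. Qed.

Lemma supp7V x : coef x 0 = 1 -> supp7 x -> supp7 (invs x).
Proof.
move=> x0 hx n; elim/ltn_ind: n => n IH hn.
have := congr1 (fun z => coef z n) (mulsV x0).
rewrite coefsM big_ord_recl x0 mul1r subn0 coefs1.
have -> : (n == 0)%N = false by apply/eqP; lia.
rewrite big1 ?addr0 // => i _.
case: (boolP (7 %| lift ord0 i)%N) => hi; last by rewrite hx ?mul0r.
rewrite lift0 in hi; rewrite [nat_of_ord (lift _ _)]lift0.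
by rewrite IH ?mulr0 //; have := ltn_ord i; lia.
Qed.

Lemma red_prodq k N : red (prodq _ k N) = prodq _ k N.
Proof.
rewrite rmorph_prod; apply: eq_bigr => i _.
by rewrite rmorphB rmorph1 /= red_sX.
Qed.

(** Factor by factor, (1 - x)^7 = 1 - x^7 modulo 7. *)
Lemma red_eprod14 : red (eprod _ 14) = f2 ^+ 7.
Proof.
have h N : prodq 'F_7 14 N = prodq _ 2 N ^+ 7.
  elim: N => [|N IH]; first by rewrite /prodq !big_geq // expr1n.
  rewrite !prodqS exprMn -IH; congr (_ * _).
  have -> : (14 * N.+1 = 2 * N.+1 * 7)%N by lia.
  rewrite -sXX; move: (sX _ _) => x; symmetry.
  apply: (@eq_mod7 _ _ (- x + 3%:R * x ^+ 2 - 5%:R * x ^+ 3 + 5%:R * x ^+ 4 - 3%:R * x ^+ 5 + x ^+ 6)).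
  ring.
apply: eqm_all => N n nN.
have red_eqm k : (0 < k)%N -> eqm N.+1 (red (eprod _ k)) (prodq _ k N).
  by move=> k0 i iN; rewrite -red_prodq !coef_red (eqm_prodq int k0 (leqnn N) iN).
rewrite (red_eqm 14) ?ltnS ?(ltnW nN) // h.
apply/esym; apply: (@eqmX _ N.+1); last by rewrite ltnS ltnW.
by rewrite /f2 -lock; apply: red_eqm.
Qed.

Lemma dvd7_red (a : int) : (a%:~R == 0 :> 'F_7) = (7 %| a)%Z.
Proof. by rewrite -(dvdz_pcharf (pchar_Fp (isT : prime 7))). Qed.

Lemma red0_div7 x : red x = 0 -> exists y, x = 7%:R * y.
Proof.
move=> h; exists (Series (fun n => (coef x n %/ 7)%Z)).
apply: seriesP => n; rewrite coefs_natM /= mulrC divzK // -dvd7_red -coef_red h.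
by rewrite coefs0.
Qed.

Definition euler1 := eprod int 1.
Definition euler2 := eprod int 2.
Definition inv_f2_7 : series int := invs euler2 ^+ 7.
Definition inv_f14 : series int := invs (eprod int 14).

Lemma red_invs (x : series int) : coef x 0 = 1 -> red (invs x) = invs (red x).
Proof.
move=> x0; apply: invs_uniq; first exact: coef0_red.
by rewrite -rmorphM mulsV // rmorph1.
Qed.

Lemma red_invs_e2 : red (invs euler2) = i2.
Proof. by rewrite red_invs ?coef0_eprod // /i2 /f2 -!lock. Qed.

Lemma red_w : red inv_f14 = i2 ^+ 7.
Proof.
rewrite /inv_f14 red_invs ?coef0_eprod // red_eprod14 invsX ?coef0_f2 //.
by rewrite /i2 -lock.
Qed.

Lemma exists_V : exists V, inv_f2_7 = inv_f14 + 7%:R * V.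
Proof.
have [|V hV] := @red0_div7 (inv_f2_7 - inv_f14).
  by rewrite rmorphB rmorphXn /= red_invs_e2 red_w subrr.
by exists V; rewrite -hV; ring.
Qed.

Lemma theta_invs (R : comNzRingType) (x : series R) : coef x 0 = 1 ->
  theta (invs x) = - theta x * invs x ^+ 2.
Proof.
move=> x0; apply: (cancels x0).
have := congr1 (@theta _) (mulsV x0); rewrite thetaM theta1 => h.
transitivity (theta x * invs x + x * theta (invs x) - theta x * invs x); first by ring.
rewrite h; transitivity (- theta x * invs x * (x * invs x)); last by ring.
by rewrite mulsV //; ring.
Qed.

(** One seventh of theta(1/f_14); the quotient n/7 is exact on the support of 1/f_14. *)
Definition zw : series int := Series (fun n => (n %/ 7)%:R * coef inv_f14 n).

Lemma coef_zw n : coef zw n = (n %/ 7)%:R * coef inv_f14 n.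
Proof. by []. Qed.

Lemma coef_w0 n : ~~ (7 %| n)%N -> coef inv_f14 n = 0.
Proof. exact: supp7V (coef0_eprod _ _) supp7_eprod n. Qed.

Lemma coef_theta (R : comNzRingType) (x : series R) n :
  coef (theta x) n = n%:R * coef x n.
Proof. by []. Qed.

Lemma theta_w : theta inv_f14 = 7%:R * zw.
Proof.
apply: seriesP => n; rewrite coefs_natM coef_theta coef_zw mulrA -natrM.
case: (boolP (7 %| n)%N) => hn; first by rewrite [(7 * _)%N]mulnC divnK.
by rewrite coef_w0 // !mulr0.
Qed.

Lemma theta_red_zw : theta (red zw) = 0.
Proof.
apply: seriesP => n; rewrite coef_theta coef_red coef_zw coefs0.
case: (boolP (7 %| n)%N) => hn; first by rewrite F7_nat0 // mul0r.
by rewrite coef_w0 // !mulr0.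
Qed.

(** theta(f_2^-7) = -7 theta(f_2) f_2^-8 and theta(1/f_14) = 7 zw both carry a factor 7, which can
    be divided out over Z before reducing. *)
Lemma theta_red_V V : inv_f2_7 = inv_f14 + 7%:R * V ->
  theta (red V) = - (3%:R * (ms - 1)) * i2 ^+ 7 - red zw.
Proof.
move=> hV; have e20 : coef euler2 0 = 1 by apply: coef0_eprod.
have h : theta V = - theta euler2 * invs euler2 ^+ 8 - zw.
  apply: (@series_natI 7) => //.
  have := congr1 (@theta _) hV; rewrite thetaD theta_natM theta_w /inv_f2_7 thetaX theta_invs // => h7.
  transitivity (7%:R * zw + 7%:R * theta V - 7%:R * zw); first by ring.
  by rewrite -h7 /=; ring.
rewrite -red_theta h rmorphB rmorphM rmorphN rmorphXn /= red_theta red_invs_e2.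
have -> : red euler2 = f2 by rewrite /f2 -lock.
rewrite theta_f2; congr (_ - _).
transitivity (- (3%:R * (ms - 1)) * (f2 * i2) * i2 ^+ 7); first by ring.
by rewrite f2i2 mulr1.
Qed.

(** * The binary form x^2 + 2 y^2 *)

(** -2 is not a square modulo 7: cubing a^2 = -2 b^2 gives a^6 = -b^6, against Fermat unless a = b =
    0. *)
Lemma anisotropic7 (x y : int) : (7 %| x ^+ 2 + 2 * y ^+ 2)%Z ->
  (7 %| x)%Z /\ (7 %| y)%Z.
Proof.
rewrite -!dvd7_red rmorphD rmorphM !rmorphXn /= => h.
suff [-> ->] : x%:~R = 0 :> 'F_7 /\ y%:~R = 0 :> 'F_7 by [].
move: (x%:~R) (y%:~R) h => a b /eqP.
have [->|b0] := eqVneq b 0.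
  by rewrite expr0n /= mulr0 addr0 => /eqP; rewrite sqrf_eq0 => /eqP.
move=> h; have ha : a ^+ 2 = - 2%:~R * b ^+ 2 by apply/eqP; rewrite -subr_eq0 -h; apply/eqP; ring.
have : a ^+ 6 = - b ^+ 6.
  rewrite (exprM a 2 3) ha exprMn -exprM [X in X * _](_ : _ = -1) ?mulN1r //.
  by apply/eqP.
rewrite (Fermat7 b0); have [->|a0] := eqVneq a 0.
  by rewrite expr0n => /eqP.
by rewrite Fermat7 // => /eqP.
Qed.

Definition psi_jac2 := psi triv_sign * jac2.

(** A term of index i has x^2 + 2 y^2 = 8i + 3 with x = 4 p.1 + 1 and y = 4 p.2 + 1. For i = 4
    modulo 7 this is divisible by 7, so 7 divides x and the weight y, and 49 divides 8i + 3, that is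
    i = 18 modulo 49. *)
Lemma coef_F i : (i %% 7 = 4)%N ->
  (7 %| coef psi_jac2 i)%Z /\ ((i %% 49)%N <> 18%N -> coef psi_jac2 i = 0).
Proof.
move=> hi; rewrite /psi_jac2 /psi /jac2 (thM _ _ dominated_tri dominated_tri2) /=.
have key p : (E_tri p.1 + E_tri2 p.2)%N == i -> (7 %| 4 * p.2 + 1)%Z /\ (i %% 49 = 18)%N.
  move=> /eqP Ei.
  have e : (4 * p.1 + 1) ^+ 2 + 2 * (4 * p.2 + 1) ^+ 2 = 8 * i%:Z + 3.
    have := E_triE p.1; have := E_tri2E p.2; rewrite !natz -Ei PoszD => -> ->; ring.
  have [/dvdzP[a ha] /dvdzP[b hb]] : (7 %| 4 * p.1 + 1)%Z /\ (7 %| 4 * p.2 + 1)%Z.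
    by apply: anisotropic7; rewrite e; lia.
  split; first by rewrite hb dvdz_mull.
  have : 49 * (a ^+ 2 + 2 * b ^+ 2) = 8 * i%:Z + 3 by rewrite -e ha hb; ring.
  by move: (a ^+ 2 + _) => c hc; lia.
split; last by move=> h; rewrite big1 // => p /key [].
by apply: rpred_sum => p /key [h _]; rewrite dvdz_mull.
Qed.

Lemma coef_Fw m : (m %% 49 = 39)%N -> (49 %| coef (psi_jac2 * inv_f14) m)%Z.
Proof.
move=> hm; rewrite coefsM; apply: rpred_sum => i _.
have im := ltn_ord i.
case: (boolP (7 %| m - i)%N) => h7; last first.
  by rewrite (coef_w0 h7) mulr0 dvdz0.
have [|hF1 hF2] := @coef_F i; first by lia.
have [h|/eqP/hF2 ->] := eqVneq (i %% 49)%N 18%N; last by rewrite mul0r dvdz0.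
(* One 7 comes from F. For the other, (m - i)/7 = 3 modulo 7, and modulo 7 the coefficient of 1/f_14
   is that of 1/f_2 at this index, which vanishes. *)
suff : (7%Z * 7%Z %| coef psi_jac2 i * coef inv_f14 (m - i))%Z by [].
apply: dvdz_mul => //; rewrite -dvd7_red -coef_red red_w frob_series h7.
by rewrite coef_i2_0 //; lia.
Qed.

Lemma red_F : red psi_jac2 = mF.
Proof. by rewrite /psi_jac2 jacobi2 rmorphM rmorphXn /mF /mpsi /f2 -!lock. Qed.

Lemma coef_Fv m : (m %% 49 = 39)%N -> (49 %| coef (psi_jac2 * inv_f2_7) m)%Z.
Proof.
move=> hm; have [V hV] := exists_V.
have -> : psi_jac2 * inv_f2_7 = psi_jac2 * inv_f14 + 7%:R * (psi_jac2 * V) by rewrite hV; ring.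
rewrite coefsD coefs_natM rpredD ?coef_Fw //.
suff : (7%Z * 7%Z %| 7%:R * coef (psi_jac2 * V) m)%Z by [].
rewrite dvdz_mul // -dvd7_red -coef_red.
have -> : red (psi_jac2 * V) = mF * red V by rewrite -red_F -rmorphM.
by rewrite (coef_mF_V hm (theta_red_V hV) theta_red_zw).
Qed.

Lemma Fv_inverse : psi_jac2 * inv_f2_7 * (euler1 * euler2 ^+ 2) = 1.
Proof.
rewrite /psi_jac2 /inv_f2_7 jacobi2 -/euler2.
transitivity (psi triv_sign * euler1 * euler2 ^+ 5 * invs euler2 ^+ 7); first by ring.
rewrite gauss_psi -/euler2; transitivity ((euler2 * invs euler2) ^+ 7); first by ring.
by rewrite mulsV ?expr1n // coef0_eprod.
Qed.

(** * The generating function *)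

Definition emb (A : fps) : series int := Series (fun n => (A n)%:R).

Lemma embM A B : emb (fps_mul A B) = emb A * emb B.
Proof.
apply: seriesP => n; rewrite coefsM /= natr_sum; apply: eq_bigr => i _.
by rewrite natrM.
Qed.

Lemma emb1 : emb fps_one = 1.
Proof. by []. Qed.

Lemma emb_geom j : (0 < j)%N -> emb (geom j) * (1 - sX _ j) = 1.
Proof.
move=> j0; apply: seriesP => n; rewrite mulrBr mulr1 mulrC coefsB coefs_sXM coefs1 /= /geom.
case: leqP => jn; last first.
  rewrite subr0; congr (nat_of_bool _)%:R; apply/idP/eqP => [|->]; last exact: dvdn0.
  by case: n jn => // n jn /dvdn_leq; lia.
rewrite dvdn_subl // subrr.
by have -> : (n == 0)%N = false by apply/eqP; lia.
Qed.

Lemma emb_inv_f_trunc k N : (0 < k)%N -> emb (inv_f_trunc k N) * prodq _ k N = 1.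
Proof.
move=> k0; rewrite /inv_f_trunc /prodq unlock /reducebig.
have : all (fun m => 0 < m)%N (index_iota 1 N.+1).
  by apply/allP => m; rewrite mem_index_iota => /andP[].
elim: (index_iota _ _) => [_|m r IH /= /andP[m0 hr]] /=; first by rewrite mulr1.
rewrite embM mulrACA IH // emb_geom ?mulr1 //.
by rewrite muln_gt0 k0.
Qed.

(** The truncated series and F/f_2^7 both invert f_1 f_2^2 modulo q^(m+1). *)
Lemma coef_a_gen m : (a_gen 3 m)%:Z = coef (psi_jac2 * inv_f2_7) m.
Proof.
have -> : (a_gen 3 m)%:Z = coef (emb (inv_f_trunc 1 m) * emb (inv_f_trunc 2 m) ^+ 2) m.
  transitivity (coef (emb (fps_mul (inv_f_trunc 1 m)
      (\big[fps_mul/fps_one]_(0 <= i < 2) inv_f_trunc 2 m))) m); first by rewrite /= natz.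
  by rewrite embM 2?big_ltn // big_geq // !embM emb1 mulr1.
set y := emb _ * _.
have hy : y * (prodq _ 1 m * prodq _ 2 m ^+ 2) = 1.
  have h1 := @emb_inv_f_trunc 1 m isT; have h2 := @emb_inv_f_trunc 2 m isT.
  rewrite /y mulrACA h1 mul1r -exprMn h2; exact: expr1n.
have h : eqm m.+1 (y * (euler1 * euler2 ^+ 2)) 1.
  rewrite -hy; apply: eqmM => //; apply: eqmM; first exact: eqm_prodq.
  by apply: eqmX; apply: eqm_prodq.
have : eqm m.+1 (y * (euler1 * euler2 ^+ 2) * (psi_jac2 * inv_f2_7)) (1 * (psi_jac2 * inv_f2_7)) by apply: eqmM.
by rewrite mul1r -mulrA [_ * (psi_jac2 * inv_f2_7)]mulrC Fv_inverse mulr1; apply.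
Qed.

Local Close Scope ring_scope.

Theorem theorem1p2 (n : nat) : a_gen 3 (7 ^ 2 * n + 39) = 0 %[mod 7 ^ 2].
Proof.
have h : (7 ^ 2 * n + 39) %% 49 = 39 by lia.
have := coef_Fv h; rewrite -coef_a_gen => h49.
have /dvdnP[k ->] : 7 ^ 2 %| a_gen 3 (7 ^ 2 * n + 39) by [].
by rewrite modnMl mod0n.
Qed.
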